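(* Let $\alpha,\beta\in[0,1)$ and $\gamma=1-2(1-\alpha)(1-\beta)$. If $\gamma\ge 0$, then $\mathcal{P}_H^0(\alpha)*\mathcal{G}_H^0(\beta)\subset\mathcal{K}_H^0$; that is, for every $f\in\mathcal{P}_H^0(\alpha)$ and every $F\in\mathcal{G}_H^0(\beta)$, the harmonic convolution $f*F$ belongs to $\mathcal{K}_H^0$. In particular, $\mathcal{P}_H^0(0)*\mathcal{G}_H^0(1/2)\subset\mathcal{K}_H^0$ and $\mathcal{P}_H^0(1/2)*\mathcal{G}_H^0(0)\subset\mathcal{K}_H^0$.
   Context: Let $\mathbb{D}=\{z\in\mathbb{C}:|z|<1\}$. $\mathcal{H}_0$ is the class of complex-valued harmonic functions $f=h+\overline{g}$ on $\mathbb{D}$, where $h,g$ are analytic on $\mathbb{D}$ with $h(0)=0$, $h'(0)=1$, $g(0)=0$, $g'(0)=0$; thus $h(z)=z+\sum_{n\ge2}a_nz^n$ and $g(z)=\sum_{n\ge2}b_nz^n$. For $\alpha<1$, $\mathcal{P}_H^0(\alpha)=\{f=h+\overline{g}\in\mathcal{H}_0:\ \mathrm{Re}\,(h'(z)-\alpha)>|g'(z)|\text{ for all }z\in\mathbb{D}\}$. For $\beta<1$, $\mathcal{G}_H^0(\beta)=\{f=h+\overline{g}\in\mathcal{H}_0:\ \mathrm{Re}\left(\frac{h(z)}{z}\right)-\beta>\left|\frac{g(z)}{z}\right|\text{ for all }z\in\mathbb{D}\}$, where the quotients are extended analytically to $z=0$. For $f=h+\overline{g}$, $F=H+\overline{G}$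 in $\mathcal{H}_0$ with $h(z)=z+\sum_{n\ge2}a_nz^n$, $g(z)=\sum_{n\ge2}b_nz^n$, $H(z)=z+\sum_{n\ge2}A_nz^n$, $G(z)=\sum_{n\ge2}B_nz^n$, the harmonic convolution is $(f*F)(z)=z+\sum_{n\ge2}a_nA_nz^n+\sum_{n\ge2}\overline{b_nB_n}\,\overline{z}^n$. For sets $\mathcal{P},\mathcal{Q}$ of such functions, $\mathcal{P}*\mathcal{Q}=\{f*F: f\in\mathcal{P},F\in\mathcal{Q}\}$. $\mathcal{S}_H^0$ is the class of $f\in\mathcal{H}_0$ that are univalent (injective) and sense-preserving in $\mathbb{D}$ (i.e. $|h'|^2-|g'|^2>0$ on $\mathbb{D}$). A domain is close-to-convex if its complement in $\mathbb{C}$ can be written as a union of non-intersecting half-lines. $\mathcal{K}_H^0$ is the class of $f\in\mathcal{S}_H^0$ such that $f(\mathbb{D})$ is close-to-convex. *)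

(* Defs.v *)
From Stdlib Require Import Reals Factorial.
From Coquelicot Require Import Coquelicot.

Open Scope R_scope.

Definition unit_disc (z : C) : Prop := Cmod z < 1.

Definition analytic_at (h : C -> C) (z0 : C) : Prop :=
  exists (c : nat -> C) (r : R), 0 < r /\
    forall z : C, Cmod (z - z0)%C < r -> is_pseries c (z - z0)%C (h z).

Definition analytic_on_disc (h : C -> C) : Prop :=
  forall z0 : C, unit_disc z0 -> analytic_at h z0.

(* A harmonic function f = h + conj g on the disc is represented by the pair
   (h, g), which f determines once g(0) = 0.  Every notion below depends only
   on the values of h and g inside the disc. *)
Record harmonic_map := HarmonicMap { hpart : C -> C ; gpart : C -> C }.

Definition harmonic_fun (f : harmonic_map) (z : C) : C :=
  (hpart f z + Cconj (gpart f z))%C.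

Coercion harmonic_fun : harmonic_map >-> Funclass.

Definition class_H0 (f : harmonic_map) : Prop :=
  analytic_on_disc (hpart f) /\ analytic_on_disc (gpart f) /\
  hpart f 0 = 0 /\ C_derive (hpart f) 0 = 1 /\
  gpart f 0 = 0 /\ C_derive (gpart f) 0 = 0.

Definition class_PH0 (alpha : R) (f : harmonic_map) : Prop :=
  class_H0 f /\
  forall z : C, unit_disc z ->
    Re (C_derive (hpart f) z - alpha)%C > Cmod (C_derive (gpart f) z).

(* h(z)/z for h vanishing at 0; its analytic extension takes the value h'(0)
   at the origin. *)
Definition quot_id (h : C -> C) (z : C) : C :=
  if Ceq_dec z 0 then C_derive h 0 else (h z / z)%C.

Definition class_GH0 (beta : R) (f : harmonic_map) : Prop :=
  class_H0 f /\
  forall z : C, unit_disc z ->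
    Re (quot_id (hpart f) z) - beta > Cmod (quot_id (gpart f) z).

Definition taylor_coef (h : C -> C) (n : nat) : C :=
  (Nat.iter n C_derive h 0 / INR (fact n))%C.

(* Like Coquelicot's [Series], total: it is the sum when the series converges. *)
Definition C_Series (u : nat -> C) : C :=
  (Series (fun n => Re (u n)), Series (fun n => Im (u n))).

(* Sum over n >= 2 of a_n A_n z^n, where a_n and A_n are the Taylor
   coefficients at 0 of h and k. *)
Definition hadamard_tail (h k : C -> C) (z : C) : C :=
  C_Series (fun m => let n := (m + 2)%nat in
    (taylor_coef h n * taylor_coef k n * z ^ n)%C).

(* The sum of conj (b_n B_n) * conj z ^ n is the conjugate of the sum of
   b_n B_n z^n. *)
Definition harmonic_conv (f F : harmonic_map) : harmonic_map :=
  HarmonicMap (fun z => (z + hadamard_tail (hpart f) (hpart F) z)%C)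
              (hadamard_tail (gpart f) (gpart F)).

Definition univalent (f : C -> C) : Prop :=
  forall z w : C, unit_disc z -> unit_disc w -> f z = f w -> z = w.

Definition sense_preserving (f : harmonic_map) : Prop :=
  forall z : C, unit_disc z ->
    Cmod (C_derive (hpart f) z) ^ 2 - Cmod (C_derive (gpart f) z) ^ 2 > 0.

Definition class_SH0 (f : harmonic_map) : Prop :=
  class_H0 f /\ univalent f /\ sense_preserving f.

Definition half_line (p d w : C) : Prop :=
  exists t : R, 0 <= t /\ w = (p + t * d)%C.

(* The family L lists half-lines by origin and direction; directions have
   modulus 1, so distinct pairs are distinct half-lines. *)
Definition close_to_convex (Omega : C -> Prop) : Prop :=
  exists L : C -> C -> Prop,
    (forall p d, L p d -> Cmod d = 1) /\
    (forall p d p' d', L p d -> L p' d' -> (p, d) <> (p', d') ->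
       forall w, ~ (half_line p d w /\ half_line p' d' w)) /\
    (forall w, ~ Omega w <-> exists p d, L p d /\ half_line p d w).

Definition disc_image (f : C -> C) (w : C) : Prop :=
  exists z : C, unit_disc z /\ f z = w.

Definition class_KH0 (f : harmonic_map) : Prop :=
  class_SH0 f /\ close_to_convex (disc_image f).

(* Main.v *)
Require Import Defs.
From Stdlib Require Import Reals Lra Lia Factorial List Classical ClassicalEpsilon FunctionalExtensionality.
From Coquelicot Require Import Coquelicot.
Open Scope R_scope.

(** Write h' = p, g' = p2 for f and H(z)/z = q, G(z)/z = q2 for F.  With z = a b, |a|, |b| < 1,
    the average over |zeta| = 1 of
      (Re p(a zeta) - alpha) (Re q(b conj zeta) - beta)
    is (Re (p*q)(z) - gamma) / 2, and it is positive and dominates the modulus of the average of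
    p2(a zeta) q2(b conj zeta), which is (p2*q2)(z); hence the convolution lies in P_H^0(gamma).
    A map f with Re h' > |g'| is strictly monotone: <f z - f w, z - w> > 0, so it is univalent.
    If w is not in the image, Minty's argument gives a unique d with |d| = 1 and
    <f zeta - w, zeta - d> >= 0 for all zeta in the disc; this persists along the half-line w + t d,
    and the maximal such half-lines fill the complement without meeting.
    Integrals are replaced by averages over roots of unity, also in the proof that functions
    analytic at each point of the disc are the sums of their Taylor series there. *)

(** * Finite sums *)

(** Analyticity is given locally, by one convergent power series around each point, while the
    convolution is built from Taylor coefficients at 0. One series valid on the whole disc is
    therefore needed before anything can be averaged. Roots of unity suffice because the means of
    products of truncated series are exact, and truncation costs only tails that are uniform on the
    circle.

    The two classes meet through n a_n A_n = (n a_n) A_n: the derivative of the convolved analytic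
    part is the Hadamard product of h' and H(z)/z, so one hypothesis applies to each factor. Limits
    of averages keep only weak inequalities; a positive lower bound on a compact subdisc restores
    the strict one.

    On the geometric side f need not have boundary values, so the half-lines cannot simply be issued
    from points f(d) with |d| = 1. Minty's form of the inequality evaluates f at interior test
    points only, and compactness of the closed disc supplies the boundary point d. Disjointness
    includes the origins of the half-lines, which forces each of them to be extended backwards as
    far as possible. *)

Fixpoint rsum (f : nat -> R) (n : nat) : R :=
  match n with O => 0 | S m => rsum f m + f m end.

Fixpoint csum (f : nat -> C) (n : nat) : C :=
  match n with O => RtoC 0 | S m => (csum f m + f m)%C end.

Lemma rsum_ext f g n : (forall i, (i < n)%nat -> f i = g i) -> rsum f n = rsum g n.
Proof. induction n as [|n IH]; simpl; intros H; trivial. rewrite IH, H; auto with arith. Qed.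

Lemma rsum_plus f g n : rsum (fun i => f i + g i) n = rsum f n + rsum g n.
Proof. induction n as [|n IH]; simpl; [ring|]. rewrite IH; ring. Qed.

Lemma rsum_minus f g n : rsum (fun i => f i - g i) n = rsum f n - rsum g n.
Proof. induction n as [|n IH]; simpl; [ring|]. rewrite IH; ring. Qed.

Lemma rsum_scal a f n : rsum (fun i => a * f i) n = a * rsum f n.
Proof. induction n as [|n IH]; simpl; [ring|]. rewrite IH; ring. Qed.

Lemma rsum_const a n : rsum (fun _ => a) n = INR n * a.
Proof. induction n as [|n IH]; [simpl; ring|]. rewrite S_INR; simpl; rewrite IH; ring. Qed.

Lemma rsum_le f g n : (forall i, (i < n)%nat -> f i <= g i) -> rsum f n <= rsum g n.
Proof.
  induction n as [|n IH]; simpl; intros H; [lra|].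
  apply Rplus_le_compat; auto with arith.
Qed.

Lemma rsum_ge0 f n : (forall i, (i < n)%nat -> 0 <= f i) -> 0 <= rsum f n.
Proof. intros H. rewrite <- (Rmult_0_r (INR n)), <- rsum_const. now apply rsum_le. Qed.

Lemma rsum_le_index f m n : (m <= n)%nat -> (forall i, 0 <= f i) -> rsum f m <= rsum f n.
Proof. intros H F. induction H as [|n H IH]; simpl; [lra|]. specialize (F n); lra. Qed.

Lemma rsum_Sl f n : rsum f (S n) = f 0%nat + rsum (fun i => f (S i)) n.
Proof. induction n as [|n IH]; [simpl; ring|]. change (rsum f (S (S n))) with (rsum f (S n) + f (S n)). rewrite IH; simpl; ring. Qed.

Lemma rsum_term_le f n i : (i < n)%nat -> (forall j, 0 <= f j) -> f i <= rsum f n.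
Proof.
  intros H F. apply Rle_trans with (rsum f (S i)).
  - simpl. assert (0 <= rsum f i) by (apply rsum_ge0; auto). lra.
  - now apply rsum_le_index.
Qed.

Lemma rsum_exchange f n m :
  rsum (fun i => rsum (fun j => f i j) m) n = rsum (fun j => rsum (fun i => f i j) n) m.
Proof.
  induction n as [|n IH]; simpl.
  - rewrite rsum_const; ring.
  - now rewrite IH, <- rsum_plus.
Qed.

Lemma rsum_sum_n f n : rsum f (S n) = sum_n f n.
Proof.
  induction n as [|n IH].
  - rewrite sum_O; simpl; ring.
  - rewrite sum_Sn, <- IH; reflexivity.
Qed.

Lemma csum_ext f g n : (forall i, (i < n)%nat -> f i = g i) -> csum f n = csum g n.
Proof. induction n as [|n IH]; simpl; intros H; trivial. rewrite IH, H; auto with arith. Qed.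

Lemma csum_plus f g n : csum (fun i => f i + g i)%C n = (csum f n + csum g n)%C.
Proof. induction n as [|n IH]; simpl; [ring|]. rewrite IH; ring. Qed.

Lemma csum_minus f g n : csum (fun i => f i - g i)%C n = (csum f n - csum g n)%C.
Proof. induction n as [|n IH]; simpl; [ring|]. rewrite IH; ring. Qed.

Lemma csum_scal a f n : csum (fun i => a * f i)%C n = (a * csum f n)%C.
Proof. induction n as [|n IH]; simpl; [ring|]. rewrite IH; ring. Qed.

Lemma csum_scal_r a f n : csum (fun i => f i * a)%C n = (csum f n * a)%C.
Proof. induction n as [|n IH]; simpl; [ring|]. rewrite IH; ring. Qed.

Lemma csum_const a n : csum (fun _ => a) n = (RtoC (INR n) * a)%C.
Proof. induction n as [|n IH]; [simpl; ring|]. rewrite S_INR, RtoC_plus; simpl; rewrite IH; ring. Qed.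

Lemma csum_Sl f n : csum f (S n) = (f 0%nat + csum (fun i => f (S i)) n)%C.
Proof. induction n as [|n IH]; [simpl; ring|]. change (csum f (S (S n))) with (csum f (S n) + f (S n))%C. rewrite IH; simpl; ring. Qed.

Lemma csum_exchange f n m :
  csum (fun i => csum (fun j => f i j) m) n = csum (fun j => csum (fun i => f i j) n) m.
Proof.
  induction n as [|n IH]; simpl.
  - rewrite csum_const; ring.
  - now rewrite IH, <- csum_plus.
Qed.

Lemma Re_csum f n : Re (csum f n) = rsum (fun i => Re (f i)) n.
Proof. induction n as [|n IH]; simpl; trivial. now rewrite <- IH. Qed.

Lemma Im_csum f n : Im (csum f n) = rsum (fun i => Im (f i)) n.
Proof. induction n as [|n IH]; simpl; trivial. now rewrite <- IH. Qed.

Lemma Cconj_csum f n : Cconj (csum f n) = csum (fun i => Cconj (f i)) n.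
Proof.
  induction n as [|n IH]; simpl.
  - unfold Cconj, RtoC; simpl. now rewrite Ropp_0.
  - now rewrite Cplus_conj, IH.
Qed.

Lemma Cmod_csum_le f n : Cmod (csum f n) <= rsum (fun i => Cmod (f i)) n.
Proof.
  induction n as [|n IH]; simpl; [rewrite Cmod_0; lra|].
  eapply Rle_trans; [apply Cmod_triangle|]. lra.
Qed.

Lemma csum_single f n k :
  (k < n)%nat -> (forall i, i <> k -> f i = RtoC 0) -> csum f n = f k.
Proof.
  intros Hk H. induction n as [|n IH]; [lia|]. simpl.
  destruct (Nat.eq_dec k n) as [->|ne].
  - rewrite (csum_ext _ (fun _ => RtoC 0)), csum_const by (intros; apply H; lia). ring.
  - rewrite IH, (H n) by lia. ring.
Qed.

(** * Complex series *)

Lemma im_le_Cmod (c : C) : Rabs (Im c) <= Cmod c.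
Proof. eapply Rle_trans; [apply Rmax_r|apply (Rmax_Cmod c)]. Qed.

Lemma Cmod_le_Re_Im (c : C) : Cmod c <= Rabs (Re c) + Rabs (Im c).
Proof.
  replace c with (RtoC (Re c) + Ci * RtoC (Im c))%C at 1.
  - eapply Rle_trans; [apply Cmod_triangle|]. rewrite Cmod_mult, Cmod_Ci, !Cmod_R. lra.
  - destruct c; unfold Cplus, Cmult, RtoC, Ci; simpl; f_equal; ring.
Qed.

Lemma C_eq (a b : C) : Re a = Re b -> Im a = Im b -> a = b.
Proof. destruct a, b; simpl; intros -> ->; reflexivity. Qed.

(** Phrased as a real limit, so that squeezing and the arithmetic of real sequences apply
    directly. *)
Definition Clim (u : nat -> C) (l : C) : Prop :=
  is_lim_seq (fun n => Cmod (u n - l)%C) 0.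

Lemma is_lim_seq_squeeze0 (u v : nat -> R) :
  (forall n, 0 <= u n <= v n) -> is_lim_seq v 0 -> is_lim_seq u 0.
Proof.
  intros H Hv. apply (is_lim_seq_le_le (fun _ => 0) u v); auto. apply is_lim_seq_const.
Qed.

Lemma Clim_Re_Im u l :
  Clim u l <-> is_lim_seq (fun n => Re (u n)) (Re l) /\ is_lim_seq (fun n => Im (u n)) (Im l).
Proof.
  split.
  - intros H; split.
    + apply is_lim_seq_ext with (fun n => Re (u n - l)%C + Re l).
      { intros n. rewrite <- re_plus. f_equal. ring. }
      replace (Finite (Re l)) with (Finite (0 + Re l)) by (f_equal; ring).
      apply is_lim_seq_plus'; [|apply is_lim_seq_const].
      apply is_lim_seq_abs_0, is_lim_seq_squeeze0 with (2 := H).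
      intros n; split; [apply Rabs_pos|apply re_le_Cmod].
    + apply is_lim_seq_ext with (fun n => Im (u n - l)%C + Im l).
      { intros n. rewrite <- im_plus. f_equal. ring. }
      replace (Finite (Im l)) with (Finite (0 + Im l)) by (f_equal; ring).
      apply is_lim_seq_plus'; [|apply is_lim_seq_const].
      apply is_lim_seq_abs_0, is_lim_seq_squeeze0 with (2 := H).
      intros n; split; [apply Rabs_pos|apply im_le_Cmod].
  - intros [H1 H2].
    apply is_lim_seq_squeeze0 with (fun n => Rabs (Re (u n) - Re l) + Rabs (Im (u n) - Im l)).
    + intros n; split; [apply Cmod_ge_0|]. apply (Cmod_le_Re_Im (u n - l)%C).
    + replace (Finite 0) with (Finite (0 + 0)) by (f_equal; ring).
      apply is_lim_seq_plus'; apply -> is_lim_seq_abs_0.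
      * replace (Finite 0) with (Finite (Re l - Re l)) by (f_equal; ring).
        apply is_lim_seq_minus'; [exact H1|apply is_lim_seq_const].
      * replace (Finite 0) with (Finite (Im l - Im l)) by (f_equal; ring).
        apply is_lim_seq_minus'; [exact H2|apply is_lim_seq_const].
Qed.

Lemma Clim_unique u l l' : Clim u l -> Clim u l' -> l = l'.
Proof.
  rewrite !Clim_Re_Im. intros [A B] [A' B'].
  apply is_lim_seq_unique in A, A', B, B'.
  apply C_eq; congruence.
Qed.

Lemma Clim_ext u v l : (forall n, u n = v n) -> Clim u l -> Clim v l.
Proof. intros H. apply is_lim_seq_ext. intros n; now rewrite H. Qed.

Lemma Clim_Cmod_le u l (b : R) : Clim u l -> (forall n, Cmod (u n) <= b) -> Cmod l <= b.
Proof.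
  intros H Hb.
  assert (K : is_lim_seq (fun n => b + Cmod (u n - l)%C) (b + 0))
    by (apply is_lim_seq_plus'; [apply is_lim_seq_const|exact H]).
  rewrite Rplus_0_r in K.
  apply (is_lim_seq_le (fun _ => Cmod l) (fun n => b + Cmod (u n - l)%C) (Cmod l) b);
    [|apply is_lim_seq_const|exact K].
  intros n. replace l with (u n + - (u n - l))%C at 1 by ring.
  eapply Rle_trans; [apply Cmod_triangle|]. rewrite Cmod_opp. specialize (Hb n). lra.
Qed.

Definition summable (u : nat -> C) : Prop := ex_series (fun n => Cmod (u n)).

Lemma is_series_rsum (a : nat -> R) (l : R) : is_series a l <-> is_lim_seq (rsum a) l.
Proof.
  rewrite is_lim_seq_incr_1. split; intros H.
  - apply is_lim_seq_ext with (sum_n a); [intros n; now rewrite rsum_sum_n|exact H].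
  - change (is_lim_seq (sum_n a) l).
    apply is_lim_seq_ext with (2 := H). intros n; now rewrite rsum_sum_n.
Qed.

Lemma Series_rsum (a : nat -> R) : ex_series a -> is_lim_seq (rsum a) (Series a).
Proof. intros H. apply is_series_rsum. now apply Series_correct. Qed.

Lemma rsum_le_Series a n : ex_series a -> (forall i, 0 <= a i) -> rsum a n <= Series a.
Proof.
  intros H Ha. apply (is_lim_seq_incr_compare (rsum a)).
  - now apply Series_rsum.
  - intros k; simpl. specialize (Ha k); lra.
Qed.

Lemma ex_series_bounded a b :
  (forall i, 0 <= a i) -> (forall n, rsum a n <= b) -> ex_series a /\ Series a <= b.
Proof.
  intros Ha Hb.
  destruct (ex_finite_lim_seq_incr (rsum a) b) as [l Hl].
  - intros n; simpl; specialize (Ha n); lra.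
  - exact Hb.
  - apply is_series_rsum in Hl. split; [now exists l|].
    rewrite (is_series_unique _ _ Hl). apply is_series_rsum in Hl.
    apply (is_lim_seq_le (rsum a) (fun _ => b) l b); auto. apply is_lim_seq_const.
Qed.

Lemma summable_le u (b : nat -> R) : (forall n, Cmod (u n) <= b n) -> ex_series b -> summable u.
Proof.
  intros H Hb. apply (ex_series_le (fun n => Cmod (u n)) b); auto.
  intros n. change (norm (Cmod (u n))) with (Rabs (Cmod (u n))).
  rewrite Rabs_pos_eq by apply Cmod_ge_0. apply H.
Qed.

Lemma summable_Re u : summable u -> ex_series (fun n => Re (u n)).
Proof.
  intros H. apply (ex_series_le (fun n => Re (u n)) (fun n => Cmod (u n))); auto.
  intros n; apply re_le_Cmod.
Qed.

Lemma summable_Im u : summable u -> ex_series (fun n => Im (u n)).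
Proof.
  intros H. apply (ex_series_le (fun n => Im (u n)) (fun n => Cmod (u n))); auto.
  intros n; apply im_le_Cmod.
Qed.

Lemma summable_scal c u : summable u -> summable (fun n => c * u n)%C.
Proof.
  intros H. apply summable_le with (fun n => Cmod c * Cmod (u n)).
  - intros n; rewrite Cmod_mult; lra.
  - now apply (ex_series_scal (Cmod c) (fun n => Cmod (u n))).
Qed.

Lemma C_Series_lim u : summable u -> Clim (csum u) (C_Series u).
Proof.
  intros H. apply Clim_Re_Im; split.
  - change (Re (C_Series u)) with (Series (fun n => Re (u n))).
    apply is_lim_seq_ext with (rsum (fun n => Re (u n))); [intros; symmetry; apply Re_csum|].
    now apply Series_rsum, summable_Re.
  - change (Im (C_Series u)) with (Series (fun n => Im (u n))).
    apply is_lim_seq_ext with (rsum (fun n => Im (u n))); [intros; symmetry; apply Im_csum|].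
    now apply Series_rsum, summable_Im.
Qed.

Lemma C_Series_unique u l : Clim (csum u) l -> C_Series u = l.
Proof.
  intros H. apply Clim_Re_Im in H. destruct H as [H1 H2].
  apply C_eq; apply is_series_unique, is_series_rsum.
  - eapply is_lim_seq_ext; [|exact H1]. intros; apply Re_csum.
  - eapply is_lim_seq_ext; [|exact H2]. intros; apply Im_csum.
Qed.

Lemma C_Series_ext u v : (forall n, u n = v n) -> C_Series u = C_Series v.
Proof. intros H. unfold C_Series. f_equal; apply Series_ext; intros n; now rewrite H. Qed.

Lemma Clim_plus u v l m : Clim u l -> Clim v m -> Clim (fun n => u n + v n)%C (l + m)%C.
Proof.
  intros H K. apply is_lim_seq_squeeze0 with (fun n => Cmod (u n - l) + Cmod (v n - m)).
  - intros n; split; [apply Cmod_ge_0|].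
    replace (u n + v n - (l + m))%C with ((u n - l) + (v n - m))%C by ring.
    apply Cmod_triangle.
  - replace (Finite 0) with (Finite (0 + 0)) by (f_equal; ring).
    now apply is_lim_seq_plus'.
Qed.

Lemma Clim_scal c u l : Clim u l -> Clim (fun n => c * u n)%C (c * l)%C.
Proof.
  intros H. apply is_lim_seq_ext with (fun n => Cmod c * Cmod (u n - l)).
  - intros n. rewrite <- Cmod_mult. f_equal; ring.
  - replace (Finite 0) with (Finite (Cmod c * 0)) by (f_equal; ring).
    apply is_lim_seq_mult'; [apply is_lim_seq_const|exact H].
Qed.

Lemma Clim_const c : Clim (fun _ => c) c.
Proof.
  apply is_lim_seq_ext with (fun _ => 0); [|apply is_lim_seq_const].
  intros _. replace (c - c)%C with (RtoC 0) by ring. now rewrite Cmod_0.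
Qed.

Lemma Clim_conj u l : Clim u l -> Clim (fun n => Cconj (u n)) (Cconj l).
Proof. apply is_lim_seq_ext. intros n. now rewrite <- Cminus_conj, Cmod_conj. Qed.

Lemma C_Series_plus u v : summable u -> summable v ->
  C_Series (fun n => u n + v n)%C = (C_Series u + C_Series v)%C.
Proof.
  intros H K. apply C_Series_unique. apply Clim_ext with (fun n => csum u n + csum v n)%C.
  - intros n; now rewrite csum_plus.
  - apply Clim_plus; now apply C_Series_lim.
Qed.

Lemma C_Series_scal c u : summable u ->
  C_Series (fun n => c * u n)%C = (c * C_Series u)%C.
Proof.
  intros H. apply C_Series_unique. apply Clim_ext with (fun n => c * csum u n)%C.
  - intros n; now rewrite csum_scal.
  - apply Clim_scal; now apply C_Series_lim.
Qed.

Lemma C_Series_conj u : summable u -> C_Series (fun n => Cconj (u n)) = Cconj (C_Series u).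
Proof.
  intros H. apply C_Series_unique. apply Clim_ext with (fun n => Cconj (csum u n)).
  - intros n; now rewrite Cconj_csum.
  - apply Clim_conj; now apply C_Series_lim.
Qed.

Lemma C_Series_Cmod_le u : summable u -> Cmod (C_Series u) <= Series (fun n => Cmod (u n)).
Proof.
  intros H. apply (Clim_Cmod_le (csum u)); [now apply C_Series_lim|].
  intros n. eapply Rle_trans; [apply Cmod_csum_le|].
  apply (rsum_le_Series (fun n => Cmod (u n))); auto. intros; apply Cmod_ge_0.
Qed.

Lemma summable_S u : summable u <-> summable (fun n => u (S n)).
Proof. apply (ex_series_incr_1 (fun n => Cmod (u n))). Qed.

Lemma C_Series_S u : summable u -> C_Series u = (u 0%nat + C_Series (fun n => u (S n)))%C.
Proof.
  intros H. symmetry.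
  assert (K : Clim (fun n => csum u (S n)) (u 0%nat + C_Series (fun n => u (S n)))%C).
  { apply Clim_ext with (fun n => u 0%nat + csum (fun n => u (S n)) n)%C.
    - intros n; now rewrite csum_Sl.
    - apply Clim_plus; [apply Clim_const|]. apply C_Series_lim. now apply -> summable_S. }
  eapply Clim_unique; [exact K|].
  apply (is_lim_seq_incr_1 (fun n => Cmod (csum u n - C_Series u)%C)). now apply C_Series_lim.
Qed.

Definition tail_norm (u : nat -> C) (N : nat) : R :=
  Series (fun n => Cmod (u n)) - rsum (fun n => Cmod (u n)) N.

Lemma C_Series_tail u N : summable u -> Cmod (C_Series u - csum u N) <= tail_norm u N.
Proof.
  revert u. induction N as [|N IH]; intros u H.
  - unfold tail_norm; simpl. replace (C_Series u - 0)%C with (C_Series u) by ring.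
    rewrite Rminus_0_r. now apply C_Series_Cmod_le.
  - rewrite C_Series_S by auto. rewrite csum_Sl.
    unfold tail_norm. rewrite rsum_Sl, (Series_incr_1 (fun n => Cmod (u n))) by auto.
    apply -> summable_S in H. specialize (IH _ H). unfold tail_norm in IH.
    replace (u 0%nat + C_Series (fun n => u (S n)) - (u 0%nat + csum (fun i => u (S i)) N))%C
      with (C_Series (fun n => u (S n)) - csum (fun i => u (S i)) N)%C by ring.
    lra.
Qed.

Lemma tail_lim u : summable u -> is_lim_seq (tail_norm u) 0.
Proof.
  intros H. replace (Finite 0) with (Finite (Series (fun n => Cmod (u n)) - Series (fun n => Cmod (u n))))
    by (f_equal; ring).
  apply is_lim_seq_minus'; [apply is_lim_seq_const|]. now apply Series_rsum.
Qed.

(** * Summation by diagonals *)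

(** Both sides run over the pairs with n + k < N, by diagonals n + k = m on the left and for each k
    separately on the right. *)
Lemma triangle_S (a : nat -> nat -> R) N :
  rsum (fun m => rsum (fun k => a (m - k)%nat k) (S m)) N
  = rsum (fun k => rsum (fun n => a n k) (N - k)) N.
Proof.
  induction N as [|N IH]; [reflexivity|].
  change (rsum (fun m => rsum (fun k => a (m - k)%nat k) (S m)) (S N)) with
   (rsum (fun m => rsum (fun k => a (m - k)%nat k) (S m)) N + rsum (fun k => a (N - k)%nat k) (S N)).
  rewrite IH.
  replace (rsum (fun k => rsum (fun n => a n k) (N - k)) N) with
          (rsum (fun k => rsum (fun n => a n k) (N - k)) (S N)).
  2:{ simpl. rewrite Nat.sub_diag; simpl; ring. }
  rewrite <- rsum_plus. apply rsum_ext. intros i Hi.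
  replace (S N - i)%nat with (S (N - i)) by lia. reflexivity.
Qed.

(** A finite rectangle lies in a large triangle, which bounds the iterated sum by the diagonal one;
    a triangle lies in finitely many full rows, which gives the reverse inequality. *)
Lemma Fubini_nonneg (a : nat -> nat -> R) :
  (forall n k, 0 <= a n k) ->
  ex_series (fun m => rsum (fun k => a (m - k)%nat k) (S m)) ->
  (forall k, ex_series (fun n => a n k)) /\
  ex_series (fun k => Series (fun n => a n k)) /\
  Series (fun k => Series (fun n => a n k))
    = Series (fun m => rsum (fun k => a (m - k)%nat k) (S m)).
Proof.
  intros Ha H. set (D := fun m => rsum (fun k => a (m - k)%nat k) (S m)) in *.
  assert (HD : forall m, 0 <= D m) by (intros; apply rsum_ge0; auto).
  assert (rect : forall n K, rsum (fun k => rsum (fun i => a i k) n) K <= Series D).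
  { intros n K. apply Rle_trans with (rsum D (n + K)); [|now apply rsum_le_Series].
    unfold D. rewrite triangle_S.
    apply Rle_trans with (rsum (fun k => rsum (fun i => a i k) (n + K - k)) K).
    - apply rsum_le; intros k Hk. apply rsum_le_index; auto; lia.
    - apply rsum_le_index; [lia|]. intros; apply rsum_ge0; auto. }
  assert (row : forall k, ex_series (fun n => a n k)).
  { intros k. apply (ex_series_bounded (fun n => a n k) (Series D)); auto.
    intros n. eapply Rle_trans; [|apply (rect n (S k))].
    apply (rsum_term_le (fun k => rsum (fun i => a i k) n)); [lia|]. intros; apply rsum_ge0; auto. }
  assert (Hr : forall k, 0 <= Series (fun n => a n k)).
  { intros k. apply Rle_trans with (rsum (fun n => a n k) 0); [simpl; lra|].
    now apply rsum_le_Series. }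
  assert (cols : forall K, rsum (fun k => Series (fun n => a n k)) K <= Series D).
  { intros K.
    apply (is_lim_seq_le (fun n => rsum (fun k => rsum (fun i => a i k) n) K) (fun _ => Series D)
             (rsum (fun k => Series (fun n => a n k)) K) (Series D)).
    - intros; apply rect.
    - induction K as [|K IH]; simpl; [apply is_lim_seq_const|].
      apply is_lim_seq_plus'; [exact IH|]. now apply Series_rsum.
    - apply is_lim_seq_const. }
  destruct (ex_series_bounded _ _ Hr cols) as [E1 E2].
  split; [exact row|split; [exact E1|]].
  apply Rle_antisym; [exact E2|].
  apply (is_lim_seq_le (rsum D) (fun _ => Series (fun k => Series (fun n => a n k)))
           (Series D) (Series (fun k => Series (fun n => a n k)))).
  - intros N. unfold D. rewrite triangle_S.
    apply Rle_trans with (rsum (fun k => Series (fun n => a n k)) N).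
    + apply rsum_le; intros k Hk. now apply rsum_le_Series.
    + now apply rsum_le_Series.
  - now apply Series_rsum.
  - apply is_lim_seq_const.
Qed.

Lemma ex_series_dom (a b : nat -> R) : (forall n, Rabs (a n) <= b n) -> ex_series b -> ex_series a.
Proof. intros H. now apply (ex_series_le a b). Qed.

(** Write a = (a + b) - b: both families are nonnegative and have summable diagonals. *)
Lemma Fubini_real (a b : nat -> nat -> R) :
  (forall n k, Rabs (a n k) <= b n k) ->
  ex_series (fun m => rsum (fun k => b (m - k)%nat k) (S m)) ->
  Series (fun k => Series (fun n => a n k))
    = Series (fun m => rsum (fun k => a (m - k)%nat k) (S m)).
Proof.
  intros Hab Hb.
  assert (b0 : forall n k, 0 <= b n k)
    by (intros; eapply Rle_trans; [apply Rabs_pos|apply Hab]).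
  assert (bd : forall n k, -  b n k <= a n k <= b n k)
    by (intros; apply Rabs_le_between, Hab).
  assert (Hdom : ex_series (fun m => rsum (fun k => a (m - k)%nat k + b (m - k)%nat k) (S m))).
  { apply (ex_series_dom _ (fun m => 2 * rsum (fun k => b (m - k)%nat k) (S m))).
    - intros m. rewrite Rabs_pos_eq.
      + rewrite <- rsum_scal. apply rsum_le; intros k _. specialize (bd (m - k)%nat k); lra.
      + apply rsum_ge0; intros k _. specialize (bd (m - k)%nat k); lra.
    - now apply (ex_series_scal 2 (fun m => rsum (fun k => b (m - k)%nat k) (S m))). }
  destruct (Fubini_nonneg b b0 Hb) as [B1 [B2 B3]].
  destruct (Fubini_nonneg (fun n k => a n k + b n k)) as [A1 [A2 A3]]; auto.
  { intros n k. specialize (bd n k); lra. }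
  assert (E : forall k, Series (fun n => a n k) = Series (fun n => a n k + b n k) - Series (fun n => b n k)).
  { intros k. rewrite <- Series_minus; auto. apply Series_ext; intros; ring. }
  rewrite (Series_ext _ _ E), Series_minus, A3, B3 by auto.
  rewrite <- Series_minus by auto. apply Series_ext. intros m.
  rewrite <- rsum_minus. apply rsum_ext. intros; ring.
Qed.

Lemma Fubini_C (a : nat -> nat -> C) :
  ex_series (fun m => rsum (fun k => Cmod (a (m - k)%nat k)) (S m)) ->
  C_Series (fun k => C_Series (fun n => a n k))
    = C_Series (fun m => csum (fun k => a (m - k)%nat k) (S m)).
Proof.
  intros H. apply C_eq; unfold C_Series, Re, Im; simpl fst; simpl snd.
  - rewrite (Fubini_real (fun n k => fst (a n k)) (fun n k => Cmod (a n k))); auto.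
    + apply Series_ext; intros m. now rewrite <- Re_csum.
    + intros; apply re_le_Cmod.
  - rewrite (Fubini_real (fun n k => snd (a n k)) (fun n k => Cmod (a n k))); auto.
    + apply Series_ext; intros m. now rewrite <- Im_csum.
    + intros; apply im_le_Cmod.
Qed.

(** * Power series *)

Definition PS (c : nat -> C) (z : C) : C := C_Series (fun n => c n * z ^ n)%C.

Definition absc (c : nat -> C) (r : R) : Prop := ex_series (fun n => Cmod (c n) * r ^ n).

Lemma Cmod_term c z n : Cmod (c n * z ^ n)%C = Cmod (c n) * Cmod z ^ n.
Proof. now rewrite Cmod_mult, Cmod_pow. Qed.

Lemma absc_le c r s : 0 <= r <= s -> absc c s -> absc c r.
Proof.
  intros H. apply ex_series_dom. intros n.
  rewrite Rabs_pos_eq; [|apply Rmult_le_pos; [apply Cmod_ge_0|apply pow_le; lra]].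
  apply Rmult_le_compat_l; [apply Cmod_ge_0|]. apply pow_incr; lra.
Qed.

Lemma absc_summable c r z : absc c r -> Cmod z <= r -> summable (fun n => c n * z ^ n)%C.
Proof.
  intros H Hz. apply (absc_le _ (Cmod z)) in H; [|split; auto; apply Cmod_ge_0].
  apply ex_series_ext with (2 := H). intros n; now rewrite Cmod_term.
Qed.

(** Abel's lemma, by comparison with the geometric series of ratio r / s. *)
Lemma absc_of_bounded c r s M :
  0 <= r < s -> (forall n, Cmod (c n) * s ^ n <= M) -> absc c r.
Proof.
  intros H Hb. apply (ex_series_dom _ (fun n => M * (r / s) ^ n)).
  - intros n.
    rewrite Rabs_pos_eq; [|apply Rmult_le_pos; [apply Cmod_ge_0|apply pow_le; lra]].
    replace (r ^ n) with (s ^ n * (r / s) ^ n).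
    + rewrite <- Rmult_assoc. apply Rmult_le_compat_r; [|apply Hb].
      apply pow_le, Rdiv_le_0_compat; lra.
    + rewrite <- Rpow_mult_distr. f_equal. field; lra.
  - apply (ex_series_scal M (fun n => (r / s) ^ n)), ex_series_geom.
    rewrite Rabs_pos_eq by (apply Rdiv_le_0_compat; lra).
    apply Rlt_div_l; lra.
Qed.

Lemma absc_bounded c r : 0 <= r -> absc c r -> exists M, forall n, Cmod (c n) * r ^ n <= M.
Proof.
  intros Hr H. exists (Series (fun n => Cmod (c n) * r ^ n)). intros n.
  assert (P : forall j, 0 <= Cmod (c j) * r ^ j)
    by (intros; apply Rmult_le_pos; [apply Cmod_ge_0|now apply pow_le]).
  eapply Rle_trans; [|apply rsum_le_Series with (n := S n); auto].
  apply (rsum_term_le (fun n => Cmod (c n) * r ^ n)); auto.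
Qed.

Lemma absc_minus c d r : 0 <= r -> absc c r -> absc d r -> absc (fun n => c n - d n)%C r.
Proof.
  intros Hr H K. apply (ex_series_dom _ (fun n => Cmod (c n) * r ^ n + Cmod (d n) * r ^ n)).
  - intros n. rewrite Rabs_pos_eq; [|apply Rmult_le_pos; [apply Cmod_ge_0|now apply pow_le]].
    rewrite <- Rmult_plus_distr_r. apply Rmult_le_compat_r; [now apply pow_le|].
    unfold Cminus. rewrite <- (Cmod_opp (d n)). apply Cmod_triangle.
  - now apply (ex_series_plus (fun n => Cmod (c n) * r ^ n) (fun n => Cmod (d n) * r ^ n)).
Qed.

Lemma pow_n_Cpow (z : C) n : @pow_n C_Ring z n = (z ^ n)%C.
Proof. induction n as [|n IH]; simpl; [|rewrite IH]; reflexivity. Qed.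

Lemma csum_sum_n (f : nat -> C) n : csum f (S n) = @sum_n C_AbelianMonoid f n.
Proof.
  induction n as [|n IH].
  - rewrite sum_O. simpl. apply Cplus_0_l.
  - rewrite sum_Sn, <- IH. reflexivity.
Qed.

Lemma is_pseries_Clim c z l :
  @is_pseries C_AbsRing C_NormedModule c z l <-> Clim (csum (fun n => c n * z ^ n)%C) l.
Proof.
  unfold is_pseries, is_series, Clim.
  (* [sum_n] up to n has n + 1 terms, hence the shift by one against [csum]. *)
  rewrite is_lim_seq_incr_1.
  assert (E : forall n, @sum_n C_AbelianMonoid (fun k => @scal C_Ring C_NormedModule (@pow_n C_Ring z k) (c k)) n
     = csum (fun n => c n * z ^ n)%C (S n)).
  { intros n. rewrite csum_sum_n. apply sum_n_ext. intros k. rewrite pow_n_Cpow. apply Cmult_comm. }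
  split.
  - intros H. apply is_lim_seq_spec. intros eps.
    destruct (proj1 (@filterlim_locally_ball_norm C_AbsRing nat C_NormedModule _ _ _ _) H eps) as [N HN]. exists N. intros n Hn. specialize (HN n Hn).
    unfold ball_norm in HN. rewrite <- E.
    rewrite Rminus_0_r, Rabs_pos_eq by apply Cmod_ge_0. exact HN.
  - intros H. apply (proj2 (@filterlim_locally_ball_norm C_AbsRing nat C_NormedModule _ _ _ _)). intros eps.
    apply is_lim_seq_spec in H. destruct (H eps) as [N HN].
    exists N. intros n Hn. specialize (HN n Hn). unfold ball_norm.
    rewrite <- E, Rminus_0_r, Rabs_pos_eq in HN by apply Cmod_ge_0. exact HN.
Qed.

Lemma is_pseries_PS c z l : is_pseries c z l -> PS c z = l.
Proof. intros H. apply C_Series_unique. now apply is_pseries_Clim. Qed.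

Lemma PS_is_pseries c r z : absc c r -> Cmod z <= r -> is_pseries c z (PS c z).
Proof.
  intros H Hz. apply is_pseries_Clim. apply C_Series_lim. now apply (absc_summable c r).
Qed.

(** Partial sums of a convergent series stay within some M of the limit, so each term, a difference
    of two of them, is at most 2 M; Abel's lemma does the rest. *)
Lemma is_pseries_absc c z l r : is_pseries c z l -> 0 <= r < Cmod z -> absc c r.
Proof.
  intros H Hr. apply is_pseries_Clim in H.
  assert (B : exists M, forall n, Cmod (csum (fun n => c n * z ^ n)%C n - l) <= M).
  { destruct (filterlim_bounded (fun n => Cmod (csum (fun n => c n * z ^ n)%C n - l))) as [M HM].
    - exists 0. exact H.
    - exists M. intros n. specialize (HM n).
      eapply Rle_trans; [apply Rle_abs|exact HM]. }
  destruct B as [M HM].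
  apply absc_of_bounded with (Cmod z) (M + M); auto.
  intros n. rewrite <- Cmod_term.
  replace (c n * z ^ n)%C with ((csum (fun n => c n * z ^ n)%C (S n) - l)
     + - (csum (fun n => c n * z ^ n)%C n - l))%C by (simpl; ring).
  eapply Rle_trans; [apply Cmod_triangle|]. rewrite Cmod_opp. apply Rplus_le_compat; apply HM.
Qed.

Lemma PS_0 c : PS c 0 = c 0%nat.
Proof.
  apply C_Series_unique.
  assert (K : Clim (fun _ => c 0%nat) (c 0%nat)) by apply Clim_const.
  apply (is_lim_seq_incr_1 (fun n => Cmod (csum (fun n => c n * 0 ^ n)%C n - c 0%nat)%C)).
  eapply is_lim_seq_ext; [|exact K]. intros n. cbv beta.
  rewrite (csum_single _ (S n) 0); [f_equal; simpl; ring|lia|].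
  intros [|i] Hi; [lia|]. simpl. ring.
Qed.

Lemma absc_S c r : 0 < r -> absc c r -> absc (fun n => c (S n)) r.
Proof.
  intros Hr H. apply (ex_series_incr_1 (fun n => Cmod (c n) * r ^ n)) in H.
  apply (ex_series_scal (/ r)) in H. apply ex_series_ext with (2 := H).
  intros n. change scal with Rmult; simpl. field. lra.
Qed.

Lemma PS_S c r w : 0 < r -> absc c r -> Cmod w <= r ->
  PS c w = (c 0%nat + w * PS (fun n => c (S n)) w)%C.
Proof.
  intros Hr H Hw. unfold PS. rewrite C_Series_S by now apply (absc_summable c r).
  rewrite <- C_Series_scal.
  - f_equal; [simpl; ring|]. apply C_Series_ext. intros n; simpl; ring.
  - apply (absc_summable (fun n => c (S n)) r); auto. now apply absc_S.
Qed.

Lemma PS_Cmod_le c r w : absc c r -> Cmod w <= r ->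
  Cmod (PS c w) <= Series (fun n => Cmod (c n) * r ^ n).
Proof.
  intros H Hw. eapply Rle_trans; [apply C_Series_Cmod_le; now apply (absc_summable c r)|].
  apply Series_le; auto. intros n. split; [apply Cmod_ge_0|].
  rewrite Cmod_term. apply Rmult_le_compat_l; [apply Cmod_ge_0|].
  apply pow_incr. split; auto. apply Cmod_ge_0.
Qed.

Lemma PS_minus c d r z : absc c r -> absc d r -> Cmod z <= r ->
  PS (fun n => c n - d n)%C z = (PS c z - PS d z)%C.
Proof.
  intros Hc Hd Hz.
  replace (PS c z - PS d z)%C with (PS c z + (-(1)) * PS d z)%C by ring. unfold PS.
  rewrite <- C_Series_scal by now apply (absc_summable d r).
  rewrite <- C_Series_plus.
  - apply C_Series_ext. intros; ring.
  - now apply (absc_summable c r).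
  - apply summable_scal. now apply (absc_summable d r).
Qed.

(** The constant term is -w times a bounded factor, hence 0 as w tends to 0; then divide by w and
    repeat. The point w = 0 is excluded because this division loses it. *)
Lemma PS_eq0_coef c r : 0 < r -> absc c r ->
  (forall w, 0 < Cmod w <= r -> PS c w = RtoC 0) -> forall n, c n = RtoC 0.
Proof.
  intros Hr Hc H n. revert c Hc H.
  assert (Z : forall c, absc c r -> (forall w, 0 < Cmod w <= r -> PS c w = RtoC 0) -> c 0%nat = RtoC 0).
  { intros c Hc H. apply Cmod_eq_0. apply Rle_antisym; [|apply Cmod_ge_0].
    set (K := Series (fun n => Cmod (c (S n)) * r ^ n)).
    assert (HK : 0 <= K).
    { eapply Rle_trans; [apply (Cmod_ge_0 (PS (fun n => c (S n)) 0))|].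
      apply PS_Cmod_le; [now apply absc_S|rewrite Cmod_0; lra]. }
    apply le_epsilon. intros eps He. rewrite Rplus_0_l.
    set (d := Rmin r (eps / (K + 1))).
    assert (Hd : 0 < d) by (apply Rmin_glb_lt; auto; apply Rdiv_lt_0_compat; lra).
    assert (Md : Cmod (RtoC d) = d) by (rewrite Cmod_R; apply Rabs_pos_eq; lra).
    assert (dr : d <= r) by apply Rmin_l.
    pose proof (H (RtoC d)) as H0. rewrite (PS_S c r) in H0 by (auto; lra).
    replace (c 0%nat) with (- (RtoC d * PS (fun n => c (S n)) d))%C.
    2:{ rewrite Md in H0. rewrite <- (Cplus_0_r (- _)), <- H0 by lra. ring. }
    rewrite Cmod_opp, Cmod_mult, Md.
    apply Rle_trans with (d * K).
    - apply Rmult_le_compat_l; [lra|]. apply PS_Cmod_le; [now apply absc_S|lra].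
    - apply Rle_trans with (eps / (K + 1) * (K + 1)).
      + apply Rmult_le_compat; try lra. apply Rmin_r.
      + right; field; lra. }
  induction n as [|n IH]; intros c Hc H; [now apply Z|].
  apply (IH (fun n => c (S n))); [now apply absc_S|].
  intros w Hw. specialize (Z c Hc H). specialize (H w Hw).
  rewrite (PS_S c r), Z, Cplus_0_l in H by (auto; lra).
  assert (w <> RtoC 0) by (apply Cmod_gt_0; lra).
  replace (PS (fun n => c (S n)) w) with (/ w * (w * PS (fun n => c (S n)) w))%C by (field; auto).
  rewrite H. ring.
Qed.

Lemma PS_coef_unique c d r : 0 < r -> absc c r -> absc d r ->
  (forall w, 0 < Cmod w <= r -> PS c w = PS d w) -> forall n, c n = d n.
Proof.
  intros Hr Hc Hd H n. apply Ceq_minus.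
  apply (PS_eq0_coef (fun n => c n - d n)%C r); auto.
  - apply absc_minus; auto; lra.
  - intros w Hw. rewrite (PS_minus c d r), H by (auto; lra). ring.
Qed.

(** * Re-expansion at another centre *)

Lemma binomial_C (a b : C) m :
  ((a + b) ^ m)%C = csum (fun k => RtoC (Binomial.C m k) * a ^ (m - k) * b ^ k)%C (S m).
Proof.
  induction m as [|m IH].
  - simpl. rewrite C_n_0. ring.
  - rewrite Cpow_S, IH, Cmult_plus_distr_r.
    rewrite csum_Sl at 1.
    change (csum (fun k => RtoC (Binomial.C m k) * a ^ (m - k) * b ^ k)%C (S m))
      with (csum (fun k => RtoC (Binomial.C m k) * a ^ (m - k) * b ^ k)%C m
            + RtoC (Binomial.C m m) * a ^ (m - m) * b ^ m)%C.
    rewrite csum_Sl.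
    change (csum (fun i => RtoC (Binomial.C (S m) (S i)) * a ^ (S m - S i) * b ^ S i)%C (S m))
      with (csum (fun i => RtoC (Binomial.C (S m) (S i)) * a ^ (S m - S i) * b ^ S i)%C m
            + RtoC (Binomial.C (S m) (S m)) * a ^ (S m - S m) * b ^ S m)%C.
    rewrite (csum_ext (fun i => RtoC (Binomial.C (S m) (S i)) * a ^ (S m - S i) * b ^ S i)%C
      (fun i => a * (RtoC (Binomial.C m (S i)) * a ^ (m - S i) * b ^ S i)
           + b * (RtoC (Binomial.C m i) * a ^ (m - i) * b ^ i))%C).
    + rewrite csum_plus, !csum_scal, !C_n_0, !C_n_n, !Nat.sub_diag, !Nat.sub_0_r.
      rewrite !Cpow_S. simpl. ring.
    + intros i Hi. rewrite <- pascal, RtoC_plus by auto.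
      replace (S m - S i)%nat with (S (m - S i)) by lia.
      replace (m - i)%nat with (S (m - S i)) by lia.
      rewrite !Cpow_S. ring.
Qed.

Lemma Binomial_C_pos m k : 0 <= Binomial.C m k.
Proof.
  unfold Binomial.C. apply Rdiv_le_0_compat; [apply pos_INR|].
  apply Rmult_lt_0_compat; apply INR_fact_lt_0.
Qed.

Lemma binomial_R (a b : R) m :
  (a + b) ^ m = rsum (fun k => Binomial.C m k * a ^ (m - k) * b ^ k) (S m).
Proof.
  apply RtoC_inj. rewrite RtoC_pow, RtoC_plus, binomial_C.
  induction (S m) as [|n IH]; simpl; trivial.
  now rewrite IH, RtoC_plus, !RtoC_mult, !RtoC_pow.
Qed.

(** The k-th Taylor coefficient at z0 of the function with coefficients [c] at 0, that is, its k-th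
    derivative at z0 divided by k!. *)
Definition shift (c : nat -> C) (z0 : C) (k : nat) : C :=
  C_Series (fun n => RtoC (Binomial.C (n + k) k) * c (n + k)%nat * z0 ^ n)%C.

Lemma diagonal_binomial (c : nat -> C) a b m :
  rsum (fun k => Binomial.C (m - k + k) k * Cmod (c (m - k + k)%nat) * a ^ (m - k) * b ^ k) (S m)
  = Cmod (c m) * (a + b) ^ m.
Proof.
  rewrite binomial_R, <- rsum_scal. apply rsum_ext. intros k Hk.
  replace (m - k + k)%nat with m by lia. ring.
Qed.

(** The majorant double series for re-expansion: by the binomial theorem its diagonals are the terms
    of the absolute series at a + b. *)
Lemma shift_nonneg_terms c a b :
  0 <= a -> 0 <= b -> absc c (a + b) ->
  let u := fun n k => Binomial.C (n + k) k * Cmod (c (n + k)%nat) * a ^ n * b ^ k in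
  (forall k, ex_series (fun n => u n k)) /\ ex_series (fun k => Series (fun n => u n k)) /\
  Series (fun k => Series (fun n => u n k)) = Series (fun m => Cmod (c m) * (a + b) ^ m).
Proof.
  intros Ha Hb Hc u.
  assert (Hu : forall n k, 0 <= u n k).
  { intros n k. unfold u. apply Rmult_le_pos; [apply Rmult_le_pos; [apply Rmult_le_pos|]|].
    - apply Binomial_C_pos. - apply Cmod_ge_0. - now apply pow_le. - now apply pow_le. }
  destruct (Fubini_nonneg u Hu) as [A [B D]].
  - apply ex_series_ext with (2 := Hc). intros m. symmetry; apply diagonal_binomial.
  - split; [exact A|split; [exact B|]]. rewrite D. apply Series_ext. intros m.
    apply diagonal_binomial.
Qed.

(** The spare radius r - a plays the part of the second variable; its k-th power is then divided out
    of the row. *)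
Lemma shift_row c a k : 0 <= a -> (exists r, a < r /\ absc c r) ->
  ex_series (fun n => Binomial.C (n + k) k * Cmod (c (n + k)%nat) * a ^ n).
Proof.
  intros Ha [r [Har Hc]].
  destruct (shift_nonneg_terms c a (r - a)) as [A _]; try lra.
  { now replace (a + (r - a)) with r by ring. }
  specialize (A k). apply (ex_series_scal (/ (r - a) ^ k)) in A.
  apply ex_series_ext with (2 := A). intros n. change scal with Rmult; simpl.
  field. apply pow_nonzero; lra.
Qed.

Lemma shift_row_Cmod c z0 n k :
  Cmod (RtoC (Binomial.C (n + k) k) * c (n + k)%nat * z0 ^ n)%C
  = Binomial.C (n + k) k * Cmod (c (n + k)%nat) * Cmod z0 ^ n.
Proof. rewrite !Cmod_mult, Cmod_pow, Cmod_R, Rabs_pos_eq by apply Binomial_C_pos. ring. Qed.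

Lemma shift_summable c z0 r k : Cmod z0 < r -> absc c r ->
  summable (fun n => RtoC (Binomial.C (n + k) k) * c (n + k)%nat * z0 ^ n)%C.
Proof.
  intros H Hc. unfold summable.
  apply ex_series_ext with (fun n => Binomial.C (n + k) k * Cmod (c (n + k)%nat) * Cmod z0 ^ n).
  - intros n; now rewrite shift_row_Cmod.
  - apply shift_row; [apply Cmod_ge_0|]. now exists r.
Qed.

(** The bound on the coefficients depends on neither z0 nor k; this uniformity in the centre is what
    the continuation argument needs. *)
Lemma shift_absc c z0 r s : 0 < s -> Cmod z0 + s <= r -> absc c r ->
  absc (shift c z0) s /\
  forall k, Cmod (shift c z0 k) * s ^ k <= Series (fun m => Cmod (c m) * r ^ m).
Proof.
  intros Hs Hr Hc. pose proof (Cmod_ge_0 z0) as Hz.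
  assert (Hc' : absc c (Cmod z0 + s)) by (apply absc_le with (2 := Hc); lra).
  destruct (shift_nonneg_terms c (Cmod z0) s) as [A [B D]]; try lra; auto.
  set (u := fun n k => Binomial.C (n + k) k * Cmod (c (n + k)%nat) * Cmod z0 ^ n * s ^ k).
  change (ex_series (fun k => Series (fun n => u n k))) in B.
  change (Series (fun k => Series (fun n => u n k)) = Series (fun m => Cmod (c m) * (Cmod z0 + s) ^ m)) in D.
  assert (T : forall k, Cmod (shift c z0 k) * s ^ k <= Series (fun n => u n k)).
  { intros k. unfold u. rewrite (Series_scal_r (s ^ k)).
    apply Rmult_le_compat_r; [apply pow_le; lra|].
    eapply Rle_trans; [apply C_Series_Cmod_le, (shift_summable c z0 r); auto; lra|].
    right. apply Series_ext. intros n. apply shift_row_Cmod. }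
  assert (Ab : absc (shift c z0) s).
  { apply (ex_series_dom _ (fun k => Series (fun n => u n k))); auto.
    intros k. rewrite Rabs_pos_eq; auto.
    apply Rmult_le_pos; [apply Cmod_ge_0|apply pow_le; lra]. }
  split; [exact Ab|]. intros k.
  assert (P : forall k, 0 <= Series (fun n => u n k)).
  { intros j. eapply Rle_trans; [|apply T].
    apply Rmult_le_pos; [apply Cmod_ge_0|apply pow_le; lra]. }
  apply Rle_trans with (Series (fun k => Series (fun n => u n k))).
  - eapply Rle_trans; [apply T|].
    eapply Rle_trans; [|apply rsum_le_Series with (n := S k); auto].
    apply (rsum_term_le (fun k => Series (fun n => u n k))); auto.
  - rewrite D. apply Series_le; auto. intros m. split.
    + apply Rmult_le_pos; [apply Cmod_ge_0|apply pow_le; lra].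
    + apply Rmult_le_compat_l; [apply Cmod_ge_0|]. apply pow_incr; lra.
Qed.

(** Expanding (z0 + w)^m gives the diagonals of a double series that converges absolutely because
    |z0| + |w| <= r; summing it by powers of w instead gives the new series. *)
Lemma PS_shift c z0 w r : Cmod z0 < r -> Cmod z0 + Cmod w <= r -> absc c r ->
  PS c (z0 + w)%C = PS (shift c z0) w.
Proof.
  intros H0 H Hc. pose proof (Cmod_ge_0 z0) as Hz. pose proof (Cmod_ge_0 w) as Hw.
  set (a := fun n k => (RtoC (Binomial.C (n + k) k) * c (n + k)%nat * z0 ^ n * w ^ k)%C).
  transitivity (C_Series (fun k => C_Series (fun n => a n k))).
  - rewrite (Fubini_C a).
    + apply C_Series_ext. intros m. rewrite binomial_C, <- csum_scal. apply csum_ext.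
      intros k Hk. unfold a. replace (m - k + k)%nat with m by lia. ring.
    + apply ex_series_ext with (fun m => Cmod (c m) * (Cmod z0 + Cmod w) ^ m).
      * intros m. rewrite <- diagonal_binomial. apply rsum_ext. intros k Hk.
        unfold a. now rewrite Cmod_mult, Cmod_pow, shift_row_Cmod.
      * apply absc_le with (2 := Hc). lra.
  - apply C_Series_ext. intros k. unfold shift, a.
    rewrite Cmult_comm, <- C_Series_scal by (apply (shift_summable c z0 r); auto; lra).
    apply C_Series_ext. intros n. ring.
Qed.

(** * Complex derivatives of power series *)

(* A quadratic bound on the Taylor remainder is all that the differentiability and the
   mean value arguments need from analyticity. *)
Definition expands (f : C -> C) (z0 l : C) : Prop :=
  exists K s : R, 0 < s /\ 0 <= K /\ forall w, Cmod w < s ->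
    Cmod (f (z0 + w)%C - f z0 - l * w)%C <= K * Cmod w ^ 2.

Lemma expands_is_derive f z0 l : expands f z0 l -> is_derive f z0 l.
Proof.
  intros [K [s [Hs [HK H]]]]. split; [apply is_linear_scal_l|].
  intros x Hx. apply (@is_filter_lim_locally_unique C_AbsRing (AbsRing_NormedModule C_AbsRing)) in Hx. subst x. intros eps.
  (* K + 1 instead of K keeps the radius meaningful when K = 0. *)
  assert (Hd : 0 < Rmin s (eps / (K + 1))).
  { apply Rmin_glb_lt; auto. apply Rdiv_lt_0_compat; [apply eps|lra]. }
  exists (mkposreal _ Hd). intros y Hy; change C in y. change (Cmod (y - z0)%C < Rmin s (eps / (K + 1))) in Hy.
  change (Cmod (f y - f z0 - (y - z0) * l)%C <= eps * Cmod (y - z0)%C).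
  assert (Hy1 : Cmod (y - z0) < s) by (eapply Rlt_le_trans; [exact Hy|apply Rmin_l]).
  assert (Hy2 : Cmod (y - z0) < eps / (K + 1)) by (eapply Rlt_le_trans; [exact Hy|apply Rmin_r]).
  specialize (H (y - z0)%C Hy1). replace (z0 + (y - z0))%C with y in H by ring.
  rewrite (Cmult_comm (y - z0) l).
  eapply Rle_trans; [exact H|].
  replace (K * Cmod (y - z0) ^ 2) with (K * Cmod (y - z0) * Cmod (y - z0)) by ring.
  apply Rmult_le_compat_r; [apply Cmod_ge_0|].
  apply Rle_trans with ((K + 1) * (eps / (K + 1))).
  - apply Rmult_le_compat; try lra. apply Cmod_ge_0.
  - right; field; lra.
Qed.

Lemma expands_C_derive f z0 l : expands f z0 l -> C_derive f z0 = l.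
Proof. intros H. now apply is_C_derive_unique, expands_is_derive. Qed.

(** Splitting off two terms leaves w^2 times a power series that is bounded on |w| <= s. *)
Lemma PS_expands f z0 c s : 0 < s -> absc c s ->
  (forall w, Cmod w < s -> f (z0 + w)%C = PS c w) -> expands f z0 (c 1%nat).
Proof.
  intros Hs Hc H.
  assert (HSS : absc (fun n => c (S (S n))) s).
  { apply (absc_S (fun n => c (S n))); auto. now apply absc_S. }
  exists (Series (fun n => Cmod (c (S (S n))) * s ^ n)), s.
  split; auto. split.
  { eapply Rle_trans; [apply (Cmod_ge_0 (PS (fun n => c (S (S n))) 0))|].
    apply PS_Cmod_le; auto. rewrite Cmod_0; lra. }
  intros w Hw. rewrite H by auto.
  replace (f z0) with (f (z0 + 0)%C) by (f_equal; ring).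
  rewrite H, PS_0 by (rewrite Cmod_0; lra).
  rewrite (PS_S c s), (PS_S (fun n => c (S n)) s); try lra; auto.
  2: now apply absc_S.
  replace (c 0%nat + w * (c 1%nat + w * PS (fun n => c (S (S n))) w) - c 0%nat - c 1%nat * w)%C
    with (PS (fun n => c (S (S n))) w * (w * w))%C by ring.
  rewrite !Cmod_mult. simpl (_ ^ 2). rewrite Rmult_1_r.
  apply Rmult_le_compat_r; [apply Rmult_le_pos; apply Cmod_ge_0|].
  apply PS_Cmod_le; auto; lra.
Qed.

Definition conv_disc (c : nat -> C) : Prop := forall r, 0 <= r < 1 -> absc c r.

Definition dser (c : nat -> C) (n : nat) : C := (RtoC (INR (S n)) * c (S n))%C.

Lemma Binomial_C_1 n : Binomial.C (n + 1) 1 = INR (S n).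
Proof.
  unfold Binomial.C. replace (n + 1 - 1)%nat with n by lia. rewrite Nat.add_1_r.
  change (fact (S n)) with (S n * fact n)%nat. rewrite mult_INR. change (INR (fact 1)) with 1.
  field. apply INR_fact_neq_0.
Qed.

Lemma shift_1 c z0 : shift c z0 1 = PS (dser c) z0.
Proof.
  apply C_Series_ext. intros n. rewrite Binomial_C_1. unfold dser.
  now replace (n + 1)%nat with (S n) by lia.
Qed.

Lemma dser_conv_disc c : conv_disc c -> conv_disc (dser c).
Proof.
  intros Hc r Hr. apply ex_series_ext with (fun n => Binomial.C (n + 1) 1 * Cmod (c (n + 1)%nat) * r ^ n).
  - intros n. unfold dser. rewrite Binomial_C_1, Cmod_mult, Cmod_R, Rabs_pos_eq by apply pos_INR.
    now replace (n + 1)%nat with (S n) by lia.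
  - apply shift_row; [lra|]. exists ((1 + r) / 2). split; [lra|]. apply Hc; lra.
Qed.

Lemma conv_disc_expands h c z0 : conv_disc c -> (forall z, unit_disc z -> h z = PS c z) ->
  unit_disc z0 -> expands h z0 (PS (dser c) z0).
Proof.
  unfold unit_disc. intros Hc H Hz. rewrite <- shift_1.
  pose proof (Cmod_ge_0 z0) as Hz0.
  set (s := (1 - Cmod z0) / 2). assert (Hs : 0 < s) by (unfold s; lra).
  assert (A : absc c (Cmod z0 + s)) by (apply Hc; unfold s; lra).
  apply (PS_expands h z0 (shift c z0) s); auto.
  - apply (shift_absc c z0 (Cmod z0 + s)); auto; lra.
  - intros w Hw. rewrite H.
    + apply PS_shift with (Cmod z0 + s); auto; lra.
    + eapply Rle_lt_trans; [apply Cmod_triangle|]. unfold s in *; lra.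
Qed.

Lemma conv_disc_analytic h c : conv_disc c -> (forall z, unit_disc z -> h z = PS c z) ->
  analytic_on_disc h.
Proof.
  unfold unit_disc. intros Hc H z0 Hz. unfold unit_disc in Hz.
  pose proof (Cmod_ge_0 z0) as Hz0.
  set (s := (1 - Cmod z0) / 2). assert (Hs : 0 < s) by (unfold s; lra).
  assert (A : absc c (Cmod z0 + s)) by (apply Hc; unfold s; lra).
  exists (shift c z0), s. split; auto. intros z Hz'.
  replace (h z) with (PS (shift c z0) (z - z0)%C).
  - apply PS_is_pseries with s; [|lra]. apply (shift_absc c z0 (Cmod z0 + s)); auto; lra.
  - rewrite <- (PS_shift c z0 (z - z0)%C (Cmod z0 + s)); auto; try lra.
    replace (z0 + (z - z0))%C with z by ring. symmetry; apply H.
    replace z with (z0 + (z - z0))%C by ring.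
    eapply Rle_lt_trans; [apply Cmod_triangle|]. unfold s in *; lra.
Qed.

(** The induction on m moves k, which is therefore kept general; at k = 0 the identity yields m!
    c_m. *)
Lemma iter_dser c m k :
  (Nat.iter m dser c k * RtoC (INR (fact k)) = RtoC (INR (fact (m + k))) * c (m + k)%nat)%C.
Proof.
  revert k. induction m as [|m IH]; intros k; [simpl; ring|].
  change (Nat.iter (S m) dser c k) with (RtoC (INR (S k)) * Nat.iter m dser c (S k))%C.
  replace (S m + k)%nat with (m + S k)%nat by lia. rewrite <- IH.
  change (fact (S k)) with (S k * fact k)%nat. rewrite mult_INR, RtoC_mult. ring.
Qed.

(** Iterated derivatives are matched with termwise differentiated series inside the disc only; that
    is enough to differentiate once more at an interior point. *)
Lemma taylor_coef_PS h c n : conv_disc c -> (forall z, unit_disc z -> h z = PS c z) ->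
  taylor_coef h n = c n.
Proof.
  intros Hc H. unfold taylor_coef.
  assert (I : forall m, conv_disc (Nat.iter m dser c) /\
     forall z, unit_disc z -> Nat.iter m C_derive h z = PS (Nat.iter m dser c) z).
  { induction m as [|m [I1 I2]]; [split; auto|]. split; [now apply dser_conv_disc|].
    intros z Hz. apply expands_C_derive. now apply conv_disc_expands. }
  destruct (I n) as [_ I2]. rewrite I2, PS_0 by (red; rewrite Cmod_0; lra).
  pose proof (iter_dser c n 0) as E. rewrite Nat.add_0_r in E. simpl (fact 0) in E. simpl INR in E at 1.
  rewrite Cmult_1_r in E. rewrite E.
  assert (RtoC (INR (fact n)) <> RtoC 0) by (intros K; apply RtoC_inj in K; now apply INR_fact_neq_0 in K).
  field. auto.
Qed.

(** * Averages over roots of unity *)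

Definition node (M j : nat) : C :=
  (cos (2 * PI * INR j / INR M), sin (2 * PI * INR j / INR M)).

Lemma Cpow_cis t n : ((cos t, sin t) ^ n)%C = (cos (INR n * t), sin (INR n * t)).
Proof.
  induction n as [|n IH].
  - simpl. rewrite Rmult_0_l, cos_0, sin_0. reflexivity.
  - rewrite Cpow_S, IH, S_INR. replace ((INR n + 1) * t) with (t + INR n * t) by ring.
    rewrite cos_plus, sin_plus. unfold Cmult; simpl. f_equal; ring.
Qed.

Lemma node_mod M j : Cmod (node M j) = 1.
Proof.
  unfold Cmod, node; simpl fst; simpl snd.
  rewrite <- sqrt_1. f_equal. rewrite <- (sin2_cos2 (2 * PI * INR j / INR M)).
  unfold Rsqr; ring.
Qed.

Lemma node_conj M j : (node M j * Cconj (node M j))%C = RtoC 1.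
Proof. rewrite <- Cmod2_conj, node_mod. f_equal. ring. Qed.

Lemma node_pow M j d : (node M j ^ d)%C = (node M d ^ j)%C.
Proof. unfold node. rewrite !Cpow_cis. f_equal; f_equal; unfold Rdiv; ring. Qed.

(** Exchanging index and exponent makes the sum geometric with ratio q = [node M d]. Here q^M = 1,
    while q <> 1 since 1 - cos 2x = 2 sin^2 x > 0 for x = pi d / M in (0, pi). *)
Lemma node_sum M d : (0 < d < M)%nat -> csum (fun j => node M j ^ d)%C M = RtoC 0.
Proof.
  intros Hd. rewrite (csum_ext _ (fun j => node M d ^ j)%C) by (intros; apply node_pow).
  set (q := node M d).
  assert (HM : 0 < INR M) by (apply lt_0_INR; lia).
  assert (qM : (q ^ M)%C = RtoC 1).
  { unfold q, node. rewrite Cpow_cis.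
    replace (INR M * (2 * PI * INR d / INR M)) with (0 + 2 * INR d * PI) by (field; lra).
    rewrite cos_period, sin_period, cos_0, sin_0. reflexivity. }
  assert (q1 : q <> RtoC 1).
  { intros E. apply (f_equal fst) in E. unfold q, node in E; simpl in E.
    set (x := PI * INR d / INR M).
    replace (2 * PI * INR d / INR M) with (2 * x) in E by (unfold x; field; lra).
    rewrite cos_2a_sin in E.
    assert (0 < sin x).
    { assert (0 < INR d < INR M) by (split; [apply lt_0_INR|apply lt_INR]; lia).
      pose proof PI_RGT_0. apply sin_gt_0; unfold x.
      - apply Rdiv_lt_0_compat; [apply Rmult_lt_0_compat|]; lra.
      - apply Rlt_div_l; [lra|]. apply Rmult_lt_compat_l; lra. }
    assert (0 < sin x * sin x) by (apply Rmult_lt_0_compat; auto). lra. }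
  assert (G : forall n, ((q - 1) * csum (fun j => q ^ j) n = q ^ n - 1)%C).
  { induction n as [|n IH]; simpl; [ring|]. rewrite Cmult_plus_distr_l, IH. ring. }
  specialize (G M). rewrite qM in G.
  assert (N : (q - 1)%C <> RtoC 0) by (apply Cminus_eq_contra; auto).
  replace (csum (fun j => q ^ j)%C M) with (/ (q - 1) * ((q - 1) * csum (fun j => q ^ j) M))%C
    by (field; auto).
  rewrite G. ring.
Qed.

(** Conjugation inverts a node, so for n <> m only a power with exponent strictly between 0 and M,
    or its conjugate, remains. *)
Lemma node_sum_conj M n m : (n < M)%nat -> (m < M)%nat ->
  csum (fun j => node M j ^ n * Cconj (node M j) ^ m)%C M
  = if Nat.eq_dec n m then RtoC (INR M) else RtoC 0.
Proof.
  intros Hn Hm.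
  assert (U : forall j k, (node M j ^ k * Cconj (node M j) ^ k = 1)%C).
  { intros j k. rewrite <- Cpow_mult_l, node_conj. apply Cpow_1_l. }
  destruct (Nat.eq_dec n m) as [->|ne].
  - rewrite (csum_ext _ (fun _ => RtoC 1)), csum_const by (intros; apply U). ring.
  - destruct (Nat.lt_ge_cases n m) as [L|L].
    + rewrite (csum_ext _ (fun j => Cconj (node M j ^ (m - n)))%C).
      * rewrite <- Cconj_csum, node_sum by lia. unfold Cconj, RtoC; simpl. now rewrite Ropp_0.
      * intros j _. rewrite Cpow_conj. replace m with (n + (m - n))%nat at 1 by lia.
        rewrite Cpow_add_r, Cmult_assoc, U. ring.
    + rewrite (csum_ext _ (fun j => node M j ^ (n - m))%C).
      * apply node_sum; lia.
      * intros j _. replace n with ((n - m) + m)%nat at 1 by lia.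
        rewrite Cpow_add_r, <- Cmult_assoc, U. ring.
Qed.

(** The bound n + m < M rules out aliasing: the M-th power is 1 at every node. *)
Lemma node_sum_add M n m : (n + m < M)%nat ->
  csum (fun j => node M j ^ n * node M j ^ m)%C M
  = if Nat.eq_dec (n + m) 0 then RtoC (INR M) else RtoC 0.
Proof.
  intros H. rewrite (csum_ext _ (fun j => node M j ^ (n + m))%C)
    by (intros; now rewrite Cpow_add_r).
  destruct (Nat.eq_dec (n + m) 0) as [->|ne].
  - rewrite (csum_ext _ (fun _ => RtoC 1)), csum_const by (intros; reflexivity). ring.
  - apply node_sum; lia.
Qed.

(* With 2N+1 nodes, products of two polynomials of degree < N are averaged exactly. *)
Definition avg (N : nat) (f : C -> C) : C :=
  (csum (fun j => f (node (2 * N + 1) j)) (2 * N + 1) / RtoC (INR (2 * N + 1)))%C.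

Definition ravg (N : nat) (f : C -> R) : R :=
  rsum (fun j => f (node (2 * N + 1) j)) (2 * N + 1) / INR (2 * N + 1).

Lemma INR_nodes N : 0 < INR (2 * N + 1).
Proof. apply lt_0_INR; lia. Qed.

Lemma C_nodes N : RtoC (INR (2 * N + 1)) <> RtoC 0.
Proof. intros E. apply RtoC_inj in E. pose proof (INR_nodes N). lra. Qed.

Lemma avg_minus N f g : avg N (fun z => f z - g z)%C = (avg N f - avg N g)%C.
Proof. unfold avg. rewrite csum_minus. field. apply C_nodes. Qed.

Lemma Re_avg N f : Re (avg N f) = ravg N (fun z => Re (f z)).
Proof.
  unfold avg, ravg. unfold Cdiv. rewrite <- RtoC_inv by (pose proof (INR_nodes N); lra).
  rewrite re_scal_r, Re_csum. reflexivity.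
Qed.

Lemma ravg_le N f g : (forall z, Cmod z = 1 -> f z <= g z) -> ravg N f <= ravg N g.
Proof.
  intros H. unfold ravg. apply Rmult_le_compat_r.
  - apply Rlt_le, Rinv_0_lt_compat, INR_nodes.
  - apply rsum_le. intros; apply H, node_mod.
Qed.

Lemma ravg_ext N f g : (forall z, Cmod z = 1 -> f z = g z) -> ravg N f = ravg N g.
Proof. intros H. apply Rle_antisym; apply ravg_le; intros z Hz; rewrite H by auto; lra. Qed.

Lemma ravg_const N a : ravg N (fun _ => a) = a.
Proof. unfold ravg. rewrite rsum_const. field. pose proof (INR_nodes N); lra. Qed.

Lemma ravg_plus N f g : ravg N (fun z => f z + g z) = ravg N f + ravg N g.
Proof. unfold ravg. rewrite rsum_plus. field. pose proof (INR_nodes N); lra. Qed.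

Lemma ravg_scal N a f : ravg N (fun z => a * f z) = a * ravg N f.
Proof. unfold ravg. rewrite rsum_scal. field. pose proof (INR_nodes N); lra. Qed.

Lemma Cmod_avg_le N f : Cmod (avg N f) <= ravg N (fun z => Cmod (f z)).
Proof.
  unfold avg, ravg. rewrite Cmod_div by apply C_nodes.
  rewrite Cmod_R, Rabs_pos_eq by (pose proof (INR_nodes N); lra).
  apply Rmult_le_compat_r; [apply Rlt_le, Rinv_0_lt_compat, INR_nodes|apply Cmod_csum_le].
Qed.

(** * Averages of products of power series on the circle *)

Definition trunc (p : nat -> C) (N : nat) (z : C) : C := csum (fun n => p n * z ^ n)%C N.

(** [s] stands for conjugation or the identity and [w] for the resulting orthogonality relations, so
    that one expansion of the double sum serves both averages. *)
Lemma avg_trunc_double N p q (s : C -> C) (w : nat -> nat -> C) :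
  (forall n m, (n < N)%nat -> (m < N)%nat ->
     csum (fun j => node (2 * N + 1) j ^ n * s (node (2 * N + 1) j) ^ m)%C (2 * N + 1)
     = (w n m * RtoC (INR (2 * N + 1)))%C) ->
  avg N (fun z => trunc p N z * trunc q N (s z))%C
  = csum (fun n => csum (fun m => p n * q m * w n m)%C N) N.
Proof.
  intros H. unfold avg, trunc. set (M := (2 * N + 1)%nat) in *.
  transitivity (csum (fun n => csum (fun m => p n * q m * csum (fun j => node M j ^ n * s (node M j) ^ m) M)%C N) N
     / RtoC (INR M))%C.
  - f_equal.
    rewrite (csum_ext _ (fun j => csum (fun n => csum (fun m =>
        p n * q m * (node M j ^ n * s (node M j) ^ m))%C N) N)).
    + rewrite csum_exchange. apply csum_ext; intros n _.
      rewrite csum_exchange. apply csum_ext; intros m _. now rewrite csum_scal.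
    + intros j _. rewrite <- csum_scal_r. apply csum_ext; intros n _.
      rewrite <- csum_scal. apply csum_ext; intros m _. ring.
  - unfold Cdiv. rewrite <- csum_scal_r. apply csum_ext; intros n Hn.
    rewrite <- csum_scal_r. apply csum_ext; intros m Hm.
    rewrite H by auto. field. apply C_nodes.
Qed.

Lemma avg_trunc_conj N p q :
  avg N (fun z => trunc p N z * trunc q N (Cconj z))%C = csum (fun n => p n * q n)%C N.
Proof.
  rewrite (avg_trunc_double N p q Cconj (fun n m => if Nat.eq_dec n m then RtoC 1 else RtoC 0)).
  - apply csum_ext. intros n Hn. rewrite (csum_single _ N n); auto.
    + destruct (Nat.eq_dec n n); [ring|lia].
    + intros i Hi. destruct (Nat.eq_dec n i); [lia|ring].
  - intros n m Hn Hm. rewrite node_sum_conj by lia. destruct (Nat.eq_dec n m); ring.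
Qed.

Lemma avg_trunc N p q : (0 < N)%nat ->
  avg N (fun z => trunc p N z * trunc q N z)%C = (p 0%nat * q 0%nat)%C.
Proof.
  intros HN.
  rewrite (avg_trunc_double N p q (fun z => z) (fun n m => if Nat.eq_dec (n + m) 0 then RtoC 1 else RtoC 0)).
  - rewrite (csum_single _ N 0); auto.
    + rewrite (csum_single _ N 0); auto.
      * destruct (Nat.eq_dec (0 + 0) 0); [ring|lia].
      * intros i Hi. destruct (Nat.eq_dec (0 + i) 0); [lia|ring].
    + intros i Hi. rewrite (csum_ext _ (fun _ => RtoC 0)), csum_const; [ring|].
      intros j _. destruct (Nat.eq_dec (i + j) 0); [lia|ring].
  - intros n m Hn Hm. rewrite node_sum_add by lia. destruct (Nat.eq_dec (n + m) 0); ring.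
Qed.

Lemma summable_circle p z : summable p -> Cmod z = 1 -> summable (fun n => p n * z ^ n)%C.
Proof.
  intros H Hz. apply ex_series_ext with (2 := H).
  intros n. now rewrite Cmod_term, Hz, pow1, Rmult_1_r.
Qed.

Definition total_norm (p : nat -> C) : R := Series (fun n => Cmod (p n)).

Lemma circle_Series p z : Cmod z = 1 ->
  Series (fun n => Cmod (p n * z ^ n)%C) = total_norm p.
Proof.
  intros Hz. apply Series_ext. intros n. rewrite Cmod_term, Hz, pow1. ring.
Qed.

Lemma circle_PS_le p z : summable p -> Cmod z = 1 -> Cmod (PS p z) <= total_norm p.
Proof.
  intros H Hz. rewrite <- (circle_Series p z Hz). apply C_Series_Cmod_le. now apply summable_circle.
Qed.

Lemma circle_tail p z N : summable p -> Cmod z = 1 -> Cmod (PS p z - trunc p N z)%C <= tail_norm p N.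
Proof.
  intros H Hz. replace (tail_norm p N) with (tail_norm (fun n => p n * z ^ n)%C N).
  - apply C_Series_tail. now apply summable_circle.
  - unfold tail_norm. rewrite (circle_Series p z Hz). unfold total_norm. f_equal.
    apply rsum_ext. intros n _. rewrite Cmod_term, Hz, pow1. ring.
Qed.

Lemma circle_trunc_le p z N : summable p -> Cmod z = 1 -> Cmod (trunc p N z) <= total_norm p.
Proof.
  intros H Hz. unfold trunc. eapply Rle_trans; [apply Cmod_csum_le|].
  rewrite <- (circle_Series p z Hz). apply (rsum_le_Series (fun n => Cmod (p n * z ^ n)%C)).
  - now apply summable_circle.
  - intros; apply Cmod_ge_0.
Qed.

(** Replace the factors one at a time; on the circle each error is bounded by a tail that does not
    depend on the node. *)
Lemma avg_trunc_error N p q (s : C -> C) : summable p -> summable q ->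
  (forall z, Cmod z = 1 -> Cmod (s z) = 1) ->
  Cmod (avg N (fun z => PS p z * PS q (s z)) - avg N (fun z => trunc p N z * trunc q N (s z)))%C
  <= tail_norm p N * total_norm q + total_norm p * tail_norm q N.
Proof.
  intros Hp Hq Hs. rewrite <- avg_minus. eapply Rle_trans; [apply Cmod_avg_le|].
  rewrite <- (ravg_const N (tail_norm p N * total_norm q + total_norm p * tail_norm q N)).
  apply ravg_le. intros z Hz.
  replace (PS p z * PS q (s z) - trunc p N z * trunc q N (s z))%C
    with ((PS p z - trunc p N z) * PS q (s z) + trunc p N z * (PS q (s z) - trunc q N (s z)))%C by ring.
  eapply Rle_trans; [apply Cmod_triangle|]. rewrite !Cmod_mult.
  apply Rplus_le_compat; apply Rmult_le_compat; try apply Cmod_ge_0.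
  - now apply circle_tail.
  - apply circle_PS_le; auto.
  - now apply circle_trunc_le.
  - apply circle_tail; auto.
Qed.

Lemma avg_Clim p q (s : C -> C) (v : nat -> C) l : summable p -> summable q ->
  (forall z, Cmod z = 1 -> Cmod (s z) = 1) ->
  (forall N, avg N (fun z => trunc p N z * trunc q N (s z))%C = v N) -> Clim v l ->
  Clim (fun N => avg N (fun z => PS p z * PS q (s z))%C) l.
Proof.
  intros Hp Hq Hs Hv Hl.
  apply is_lim_seq_squeeze0 with
    (fun N => (tail_norm p N * total_norm q + total_norm p * tail_norm q N) + Cmod (v N - l)).
  - intros N; split; [apply Cmod_ge_0|].
    replace (avg N (fun z => PS p z * PS q (s z)) - l)%C
      with ((avg N (fun z => PS p z * PS q (s z)) - v N) + (v N - l))%C by ring.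
    eapply Rle_trans; [apply Cmod_triangle|]. apply Rplus_le_compat_r.
    rewrite <- Hv. now apply avg_trunc_error.
  - replace (Finite 0) with (Finite ((0 * total_norm q + total_norm p * 0) + 0)) by (f_equal; ring).
    apply is_lim_seq_plus'; [|exact Hl].
    apply is_lim_seq_plus'; apply is_lim_seq_mult'; auto using is_lim_seq_const, tail_lim.
Qed.

Lemma summable_mult p q : summable p -> summable q -> summable (fun n => p n * q n)%C.
Proof.
  intros Hp Hq. apply summable_le with (fun n => total_norm p * Cmod (q n)).
  - intros n. rewrite Cmod_mult. apply Rmult_le_compat_r; [apply Cmod_ge_0|].
    eapply Rle_trans; [|apply (rsum_le_Series (fun n => Cmod (p n)) (S n))]; auto.
    + apply (rsum_term_le (fun n => Cmod (p n))); auto. intros; apply Cmod_ge_0.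
    + intros; apply Cmod_ge_0.
  - now apply (ex_series_scal (total_norm p) (fun n => Cmod (q n))).
Qed.

Lemma avg_mult_conj p q : summable p -> summable q ->
  Clim (fun N => avg N (fun z => PS p z * PS q (Cconj z))%C) (C_Series (fun n => p n * q n)%C).
Proof.
  intros Hp Hq. apply avg_Clim with (csum (fun n => p n * q n)%C); auto.
  - intros z Hz. now rewrite Cmod_conj.
  - intros N. apply avg_trunc_conj.
  - apply C_Series_lim. now apply summable_mult.
Qed.

Lemma avg_mult p q : summable p -> summable q ->
  Clim (fun N => avg N (fun z => PS p z * PS q z)%C) (p 0%nat * q 0%nat)%C.
Proof.
  intros Hp Hq.
  apply (avg_Clim p q (fun z => z) (fun N => avg N (fun z => trunc p N z * trunc q N z)%C)); auto.
  (* At N = 0 the truncations are empty and the constant terms are missing; exactness starts at N =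
     1. *)
  apply (is_lim_seq_incr_1 (fun N => Cmod (avg N (fun z => trunc p N z * trunc q N z) - p 0%nat * q 0%nat)%C)).
  apply is_lim_seq_ext with (fun _ => 0); [|apply is_lim_seq_const].
  intros N. rewrite avg_trunc by lia.
  replace (p 0%nat * q 0%nat - p 0%nat * q 0%nat)%C with (RtoC 0) by ring. now rewrite Cmod_0.
Qed.

Lemma PS_scale p a z : PS (fun n => p n * a ^ n)%C z = PS p (a * z)%C.
Proof. apply C_Series_ext. intros n. rewrite Cpow_mult_l. ring. Qed.

(** Coefficients of the monomial z^k, so that pairing with it under [avg] extracts the k-th
    coefficient. *)
Definition kdelta (k n : nat) : C := if Nat.eq_dec n k then RtoC 1 else RtoC 0.

Lemma kdelta_lim (f : nat -> C) k : Clim (csum (fun n => f n * kdelta k n)%C) (f k).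
Proof.
  apply (is_lim_seq_incr_n _ (S k)).
  apply is_lim_seq_ext with (fun _ => 0); [|apply is_lim_seq_const].
  intros n. rewrite (csum_single _ (n + S k) k); [|lia|].
  - unfold kdelta. destruct (Nat.eq_dec k k); [|lia].
    replace (f k * 1 - f k)%C with (RtoC 0) by ring. now rewrite Cmod_0.
  - intros i Hi. unfold kdelta. destruct (Nat.eq_dec i k); [lia|ring].
Qed.

Lemma summable_kdelta k : summable (kdelta k).
Proof.
  apply (ex_series_bounded (fun n => Cmod (kdelta k n)) 1); [intros; apply Cmod_ge_0|].
  intros n. induction n as [|n IH]; [simpl; lra|]. simpl.
  destruct (Nat.eq_dec n k) as [->|ne].
  - replace (rsum (fun n => Cmod (kdelta k n)) k) with 0.
    + unfold kdelta. destruct (Nat.eq_dec k k); [|lia]. rewrite Cmod_1; lra.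
    + rewrite (rsum_ext _ (fun _ => 0)), rsum_const; [ring|].
      intros i Hi. unfold kdelta. destruct (Nat.eq_dec i k); [lia|apply Cmod_0].
  - unfold kdelta at 2. destruct (Nat.eq_dec n k); [lia|]. rewrite Cmod_0; lra.
Qed.

Lemma PS_kdelta k z : PS (kdelta k) z = (z ^ k)%C.
Proof.
  apply C_Series_unique. apply Clim_ext with (csum (fun n => z ^ n * kdelta k n)%C).
  - intros n. apply csum_ext; intros; ring.
  - apply (kdelta_lim (fun n => z ^ n)%C).
Qed.

Lemma avg_PS p : summable p -> Clim (fun N => avg N (PS p)) (p 0%nat).
Proof.
  intros Hp.
  assert (H := avg_mult p (kdelta 0) Hp (summable_kdelta 0)).
  unfold kdelta in H at 2. simpl in H. rewrite Cmult_1_r in H.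
  apply Clim_ext with (2 := H). intros N. unfold avg. f_equal.
  apply csum_ext. intros j _. rewrite PS_kdelta. simpl. ring.
Qed.

(** The averages of PS c (r z) times conj z ^ k tend to c_k r^k, and each of them is at most M in
    modulus. *)
Lemma Cauchy_estimate c r M k : 0 <= r -> absc c r ->
  (forall z, Cmod z = r -> Cmod (PS c z) <= M) -> Cmod (c k) * r ^ k <= M.
Proof.
  intros Hr Hc HM.
  set (p := fun n => (c n * RtoC r ^ n)%C).
  assert (Mr : Cmod (RtoC r) = r) by (rewrite Cmod_R; now apply Rabs_pos_eq).
  assert (Hp : summable p) by (apply (absc_summable c r); auto; lra).
  replace (Cmod (c k) * r ^ k) with (Cmod (p k)) by (unfold p; now rewrite Cmod_mult, Cmod_pow, Mr).
  rewrite <- (C_Series_unique _ _ (kdelta_lim p k)).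
  apply (Clim_Cmod_le (fun N => avg N (fun z => PS p z * PS (kdelta k) (Cconj z))%C)).
  - apply avg_mult_conj; auto using summable_kdelta.
  - intros N. eapply Rle_trans; [apply Cmod_avg_le|]. rewrite <- (ravg_const N M).
    apply ravg_le. intros z Hz. rewrite PS_kdelta, Cmod_mult, Cmod_pow, Cmod_conj, Hz, pow1, Rmult_1_r.
    unfold p. rewrite PS_scale. apply HM. rewrite Cmod_mult, Hz, Mr. ring.
Qed.

(** * Compactness of closed discs *)

Lemma close_2 (d : posreal) (x y : R) (t : Compactness.Tn 2 R) :
  Compactness.close_n 2 d (x, (y, tt)) t -> Rabs (x - fst t) < d /\ Rabs (y - fst (snd t)) < d.
Proof. destruct t as [t1 [t2 t3]]. simpl. tauto. Qed.

(** Heine-Borel for the closed disc, obtained from the compactness of the square around it; [x] is a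
    witness valid near z. *)
Lemma disc_list {X : Type} (Q : C -> X -> Prop) rho :
  (forall z, Cmod z <= rho -> exists x d, 0 < d /\
     forall z', Cmod z' <= rho -> Cmod (z' - z)%C < d -> Q z' x) ->
  exists l : list X, forall z, Cmod z <= rho -> exists x, In x l /\ Q z x.
Proof.
  intros H.
  (* The gauge must be positive on the whole square. Outside the disc, twice the gauge is |z| - rho,
     a distance within which no point of the disc lies. The factor 2 pays for closeness being
     measured coordinate by coordinate. *)
  assert (G : forall z, exists xd : option X * R, 0 < snd xd /\
     match fst xd with
     | Some x => forall z', Cmod z' <= rho -> Cmod (z' - z)%C < 2 * snd xd -> Q z' x
     | None => forall z', Cmod z' <= rho -> ~ Cmod (z' - z)%C < 2 * snd xd
     end).
  { intros z. destruct (Rle_dec (Cmod z) rho) as [Hz|Hz].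
    - destruct (H z Hz) as [x [d [Hd HQ]]]. exists (Some x, d / 2). simpl.
      split; [lra|]. intros z' Hz' Hd'. apply HQ; auto; lra.
    - exists (None, (Cmod z - rho) / 2). simpl. split; [lra|].
      intros z' Hz' Hd'. assert (Cmod z <= Cmod z' + Cmod (z' - z)%C); [|lra].
      replace z with (z' + - (z' - z))%C at 1 by ring.
      rewrite <- (Cmod_opp (z' - z)). apply Cmod_triangle. }
  set (g := fun z => proj1_sig (constructive_indefinite_description _ (G z))).
  assert (Hg : forall z, 0 < snd (g z) /\
     match fst (g z) with
     | Some x => forall z', Cmod z' <= rho -> Cmod (z' - z)%C < 2 * snd (g z) -> Q z' x
     | None => forall z', Cmod z' <= rho -> ~ Cmod (z' - z)%C < 2 * snd (g z)
     end) by (intros z; exact (proj2_sig (constructive_indefinite_description _ (G z)))).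
  set (toC := fun t : Compactness.Tn 2 R => (fst t, fst (snd t)) : C).
  (* [compactness_list] provides its finite list under a double negation only. *)
  apply NNPP. intros Hno.
  apply (compactness_list 2 (- rho, (- rho, tt)) (rho, (rho, tt))
    (fun t => mkposreal _ (proj1 (Hg (toC t))))).
  intros [l Hl]. apply Hno.
  exists (flat_map (fun t => match fst (g (toC t)) with Some x => x :: nil | None => nil end) l).
  intros z Hz.
  destruct (Hl (fst z, (snd z, tt))) as [t [Ht [_ Hc]]].
  { simpl. pose proof (re_le_Cmod z) as Hre. pose proof (im_le_Cmod z) as Him.
    unfold Re in Hre. unfold Im in Him.
    apply Rabs_le_between in Hre. apply Rabs_le_between in Him. lra. }
  assert (Hd : Cmod (z - toC t) < 2 * snd (g (toC t))).
  { assert (Hc' : Rabs (fst z - fst (toC t)) < snd (g (toC t)) /\ Rabs (snd z - snd (toC t)) < snd (g (toC t)))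
      by exact (close_2 _ _ _ _ Hc).
    eapply Rle_lt_trans; [apply Cmod_le_Re_Im|].
    change (Rabs (fst z - fst (toC t)) + Rabs (snd z - snd (toC t)) < 2 * snd (g (toC t))). lra. }
  pose proof (proj2 (Hg (toC t))) as Hm. clear Hc.
  destruct (fst (g (toC t))) as [x|] eqn:E; [|exfalso; now apply (Hm z Hz)].
  exists x. split; [|now apply Hm].
  apply in_flat_map. exists t. split; auto. rewrite E. now left.
Qed.

(** By monotonicity the largest of finitely many local constants works everywhere. Positive lower
    bounds are obtained from it in the form 1 / M. *)
Lemma disc_uniform (Q : C -> R -> Prop) rho :
  (forall z M M', 0 < M -> M <= M' -> Q z M -> Q z M') ->
  (forall z, Cmod z <= rho -> exists M d, 0 < M /\ 0 < d /\
     forall z', Cmod z' <= rho -> Cmod (z' - z)%C < d -> Q z' M) ->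
  exists M, 0 < M /\ forall z, Cmod z <= rho -> Q z M.
Proof.
  intros mono H.
  destruct (disc_list (fun z M => 0 < M /\ Q z M) rho) as [l Hl].
  { intros z Hz. destruct (H z Hz) as [M [d [HM [Hd HQ]]]]. exists M, d. split; auto. }
  assert (B : exists B, 0 < B /\ forall x, In x l -> x <= B).
  { clear Hl. induction l as [|x l [B [HB IH]]].
    - exists 1; split; [lra|]. intros x [].
    - exists (Rmax x B). split; [eapply Rlt_le_trans; [exact HB|apply Rmax_r]|].
      intros y [->|Hy]; [apply Rmax_l|]. eapply Rle_trans; [now apply IH|apply Rmax_r]. }
  destruct B as [B [HB Hmax]]. exists B. split; auto.
  intros z Hz. destruct (Hl z Hz) as [M [HM [HM0 HQ]]]. apply (mono z M B); auto.
Qed.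

(** * Analytic functions on the disc are sums of their Taylor series *)

(** One parameter controls both the radius 1 / M and the size of the coefficients, which makes the
    property monotone in M as [disc_uniform] requires. *)
Definition local_series (h : C -> C) (z0 : C) (M : R) : Prop :=
  exists d, absc d (/ M) /\ (forall w, Cmod w <= / M -> h (z0 + w)%C = PS d w) /\
    forall k, Cmod (d k) * (/ M) ^ k <= M.

Lemma local_series_mono h z M M' : 0 < M -> M <= M' -> local_series h z M -> local_series h z M'.
Proof.
  intros H0 H [d [A [B D]]].
  assert (I : 0 <= / M' <= / M).
  { split; [apply Rlt_le, Rinv_0_lt_compat; lra|now apply Rinv_le_contravar]. }
  exists d. split; [now apply absc_le with (/ M)|]. split.
  - intros w Hw. apply B. lra.
  - intros k. apply Rle_trans with M; auto. eapply Rle_trans; [|apply (D k)].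
    apply Rmult_le_compat_l; [apply Cmod_ge_0|]. now apply pow_incr.
Qed.

Lemma analytic_at_PS h z : analytic_at h z -> exists c s, 0 < s /\ absc c s /\
  forall w, Cmod w <= s -> h (z + w)%C = PS c w.
Proof.
  intros [c [r [Hr H]]]. exists c, (r / 2). split; [lra|]. split.
  (* Convergence at a point of modulus 3r/4 gives absolute convergence on the smaller radius r/2. *)
  - assert (E : Cmod (RtoC (3 * r / 4)) = 3 * r / 4) by (rewrite Cmod_R; apply Rabs_pos_eq; lra).
    assert (Ez : (z + RtoC (3 * r / 4) - z)%C = RtoC (3 * r / 4)) by ring.
    specialize (H (z + RtoC (3 * r / 4))%C). rewrite Ez, E in H.
    apply (is_pseries_absc c (RtoC (3 * r / 4)) (h (z + RtoC (3 * r / 4))%C)); [apply H; lra|rewrite E; lra].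
  - intros w Hw. symmetry. apply is_pseries_PS.
    assert (Ez : (z + w - z)%C = w) by ring.
    rewrite <- Ez at 1. apply H. rewrite Ez. lra.
Qed.

Lemma analytic_local_series h z : analytic_at h z ->
  exists M d, 0 < M /\ 0 < d /\ forall z', Cmod (z' - z)%C < d -> local_series h z' M.
Proof.
  intros A. destruct (analytic_at_PS h z A) as [c [s [Hs [Hc H]]]].
  set (B := Series (fun m => Cmod (c m) * s ^ m)).
  (* 2 / s forces 1 / M <= s / 2, so the disc of radius 1 / M about a centre within s / 2 of z stays
     within s of z; B bounds the re-expanded coefficients. *)
  set (M := Rmax (2 / s) B).
  assert (H2 : 0 < 2 / s) by (apply Rdiv_lt_0_compat; lra).
  assert (M1 : 2 / s <= M) by apply Rmax_l. assert (M2 : B <= M) by apply Rmax_r.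
  assert (I : 0 < / M <= s / 2).
  { split; [apply Rinv_0_lt_compat; lra|].
    replace (s / 2) with (/ (2 / s)) by (field; lra). apply Rinv_le_contravar; lra. }
  exists M, (s / 2). split; [lra|]. split; [lra|]. intros z' Hz'.
  destruct (shift_absc c (z' - z)%C s (/ M)) as [S1 S2]; auto; try lra.
  exists (shift c (z' - z)%C). split; auto. split.
  - intros w Hw. rewrite <- (PS_shift c (z' - z)%C w s); auto; try lra.
    rewrite <- H.
    + f_equal. ring.
    + eapply Rle_trans; [apply Cmod_triangle|]. lra.
  - intros k. eapply Rle_trans; [apply S2|]. exact M2.
Qed.

Definition represents (c : nat -> C) (h : C -> C) (r : R) : Prop :=
  (forall s, 0 <= s < r -> absc c s) /\ forall z, Cmod z < r -> h z = PS c z.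

(** Each of the first n + 1 terms of the geometric series is at least x^n. *)
Lemma INR_geom_le x n : 0 < x < 1 -> INR (S n) * x ^ n <= / (1 - x).
Proof.
  intros Hx. rewrite <- Series_geom by (rewrite Rabs_pos_eq; lra).
  apply Rle_trans with (rsum (fun k => x ^ k) (S n)).
  - rewrite <- rsum_const. apply rsum_le. intros i Hi.
    replace n with (i + (n - i))%nat at 1 by lia. rewrite pow_add.
    rewrite <- (Rmult_1_r (x ^ i)) at 2. apply Rmult_le_compat_l; [apply pow_le; lra|].
    rewrite <- (pow1 (n - i)). apply pow_incr; lra.
  - apply (rsum_le_Series (fun k => x ^ k)).
    + apply ex_series_geom. rewrite Rabs_pos_eq; lra.
    + intros; apply pow_le; lra.
Qed.

(* The Taylor coefficients of h at every centre z0, |z0| < r, are bounded by M / delta^k with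
   delta = 1/M; applying Cauchy's estimate to them as functions of z0 bounds
   |c_N| (r + delta)^N by (N + 1) M, so the disc of representation grows by delta. *)
Lemma represents_grow c h r rho M : 0 < r <= rho -> 0 < M ->
  (forall z, Cmod z <= rho -> local_series h z M) ->
  represents c h r -> represents c h (r + / M).
Proof.
  intros Hr HM Hloc [Hc Hh].
  assert (Hd : 0 < / M) by now apply Rinv_0_lt_compat.
  assert (coef : forall z0, Cmod z0 < r -> (forall w, Cmod w <= / M -> h (z0 + w)%C = PS (shift c z0) w) /\
     forall k, Cmod (shift c z0 k) * (/ M) ^ k <= M).
  { intros z0 Hz0. destruct (Hloc z0) as [d [D1 [D2 D3]]]; [lra|].
    pose proof (Cmod_ge_0 z0) as Hp.
    set (e := Rmin (/ M) ((r - Cmod z0) / 2)).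
    assert (He : 0 < e) by (apply Rmin_glb_lt; lra).
    assert (e1 : e <= / M) by apply Rmin_l.
    assert (e2 : e <= (r - Cmod z0) / 2) by apply Rmin_r.
    assert (Hce : absc c (Cmod z0 + e)) by (apply Hc; lra).
    (* The local series and the re-expanded one agree on a small disc about z0, so their
       coefficients coincide and the uniform bound passes to [shift c z0]. *)
    assert (E : d = shift c z0).
    { apply functional_extensionality. apply (PS_coef_unique d (shift c z0) e); auto.
      - apply absc_le with (2 := D1); lra.
      - apply (shift_absc c z0 (Cmod z0 + e) e); auto; lra.
      - intros w Hw. rewrite <- D2 by lra.
        rewrite <- (PS_shift c z0 w (Cmod z0 + e)); auto; try lra.
        apply Hh. eapply Rle_lt_trans; [apply Cmod_triangle|]. lra. }
    rewrite <- E. split; auto. }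
  assert (bin : forall a n k, 0 <= a < r ->
     Binomial.C (n + k) k * Cmod (c (n + k)%nat) * a ^ n * (/ M) ^ k <= M).
  { intros a n k Ha. assert (Hpow : 0 < (/ M) ^ k) by now apply pow_lt.
    apply Rle_trans with (M / (/ M) ^ k * (/ M) ^ k); [|right; unfold Rdiv; rewrite Rmult_assoc, Rinv_l by lra; ring].
    apply Rmult_le_compat_r; [lra|].
    set (b := fun n => (RtoC (Binomial.C (n + k) k) * c (n + k)%nat)%C).
    replace (Binomial.C (n + k) k * Cmod (c (n + k)%nat)) with (Cmod (b n)).
    2:{ unfold b. rewrite Cmod_mult, Cmod_R, Rabs_pos_eq; auto. apply Binomial_C_pos. }
    apply Cauchy_estimate; [lra| |].
    - unfold absc, b. apply ex_series_ext with (fun n => Binomial.C (n + k) k * Cmod (c (n + k)%nat) * a ^ n).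
      + intros m. rewrite Cmod_mult, Cmod_R, Rabs_pos_eq; auto. apply Binomial_C_pos.
      + apply shift_row; [lra|]. exists ((a + r) / 2). split; [lra|]. apply Hc; lra.
    - intros z Hz. apply Rle_div_r; [lra|]. apply (proj2 (coef z ltac:(lra)) k). }
  assert (poly : forall a N, 0 <= a < r -> Cmod (c N) * (a + / M) ^ N <= INR (S N) * M).
  { intros a N Ha. rewrite <- diagonal_binomial, <- rsum_const. apply rsum_le.
    intros k Hk. apply bin; auto. }
  assert (grow : forall s, 0 <= s < r + / M -> absc c s).
  { intros s Hs. set (e := Rmin r (r + / M - s) / 4).
    assert (e0 : 0 < Rmin r (r + / M - s)) by (apply Rmin_glb_lt; lra).
    assert (e1 : 4 * e <= r) by (unfold e; pose proof (Rmin_l r (r + / M - s)); lra).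
    assert (e2 : 4 * e <= r + / M - s) by (unfold e; pose proof (Rmin_r r (r + / M - s)); lra).
    assert (e3 : 0 < e) by (unfold e; lra).
    (* With s < b' < b, the geometric factor (b'/b)^n absorbs the linear factor n + 1 of [poly]. *)
    set (b := r - e + / M). set (b' := r - 2 * e + / M).
    assert (Hb : 0 < b' < b) by (unfold b, b'; lra).
    assert (Hx : 0 < b' / b < 1).
    { split; [apply Rdiv_lt_0_compat; lra|]. apply Rlt_div_l; lra. }
    apply absc_of_bounded with b' (M * / (1 - b' / b)); [unfold b'; lra|].
    intros n. assert (P := poly (r - e) n ltac:(lra)). fold b in P.
    replace (Cmod (c n) * b' ^ n) with (Cmod (c n) * b ^ n * (b' / b) ^ n).
    2:{ rewrite Rmult_assoc, <- Rpow_mult_distr. do 2 f_equal. field; lra. }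
    apply Rle_trans with (INR (S n) * M * (b' / b) ^ n).
    - apply Rmult_le_compat_r; auto. apply pow_le; lra.
    - replace (INR (S n) * M * (b' / b) ^ n) with (M * (INR (S n) * (b' / b) ^ n)) by ring.
      apply Rmult_le_compat_l; [lra|]. now apply INR_geom_le. }
  split; [exact grow|]. intros z Hz.
  destruct (Rlt_dec (Cmod z) r) as [L|L]; [now apply Hh|].
  set (m := Cmod z) in *.
  set (e := Rmin r (r + / M - m) / 2).
  assert (e0 : 0 < Rmin r (r + / M - m)) by (apply Rmin_glb_lt; lra).
  assert (e1 : 2 * e <= r) by (unfold e; pose proof (Rmin_l r (r + / M - m)); lra).
  assert (e2 : 2 * e <= r + / M - m) by (unfold e; pose proof (Rmin_r r (r + / M - m)); lra).
  assert (e3 : 0 < e) by (unfold e; lra).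
  (* Re-expand about t z, the point of modulus r - e on the segment from 0 to z: it lies inside the
     old disc and within 1 / M of z. *)
  set (t := (r - e) / m). assert (Hm : 0 < m) by lra.
  assert (tm : t * m = r - e) by (unfold t; field; lra).
  assert (t0 : 0 < t) by (apply Rdiv_lt_0_compat; lra).
  assert (t1 : t < 1) by (apply Rlt_div_l; lra).
  assert (Z0 : Cmod (RtoC t * z) = r - e).
  { rewrite Cmod_mult, Cmod_R, Rabs_pos_eq by lra. exact tm. }
  assert (W : Cmod (RtoC (1 - t) * z) = m - (r - e)).
  { rewrite Cmod_mult, Cmod_R, Rabs_pos_eq by lra. fold m. lra. }
  replace z with (RtoC t * z + RtoC (1 - t) * z)%C by (rewrite RtoC_minus; ring).
  rewrite (proj1 (coef (RtoC t * z)%C ltac:(lra))) by lra.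
  symmetry. apply PS_shift with m; try lra. apply grow; lra.
Qed.

(** For fixed rho < 1 one M serves all centres in |z| <= rho, so every step gains the same 1 / M and
    finitely many steps pass rho. The coefficients remain those at 0 throughout, hence do not depend
    on rho. *)
Lemma analytic_on_disc_PS h : analytic_on_disc h ->
  exists c, conv_disc c /\ forall z, unit_disc z -> h z = PS c z.
Proof.
  intros Hh.
  destruct (analytic_at_PS h 0 (Hh (RtoC 0) ltac:(unfold unit_disc; rewrite Cmod_0; lra))) as [c [s [Hs [Hc H]]]].
  assert (main : forall rho, 0 < rho < 1 -> exists r, rho < r /\ represents c h r).
  { intros rho Hrho.
    destruct (disc_uniform (local_series h) rho) as [M [HM HQ]].
    - apply local_series_mono.
    - intros z Hz. destruct (analytic_local_series h z) as [M [d [A [B D]]]].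
      + apply Hh. unfold unit_disc; lra.
      + exists M, d. auto.
    - set (r0 := Rmin s rho).
      assert (Hr0 : 0 < r0) by (apply Rmin_glb_lt; lra).
      assert (base : represents c h r0).
      { split.
        - intros t Ht. apply absc_le with (2 := Hc). pose proof (Rmin_l s rho). unfold r0 in Ht; lra.
        - intros z Hz. rewrite <- H; [f_equal; ring|].
          pose proof (Rmin_l s rho). unfold r0 in Hz; lra. }
      assert (Hd : 0 < / M) by now apply Rinv_0_lt_compat.
      (* The disjunction stops the iteration once rho is passed, because [represents_grow] needs a
         radius of at most rho. *)
      assert (step : forall n, (exists r, rho < r /\ represents c h r) \/ represents c h (r0 + INR n * / M)).
      { induction n as [|n [IH|IH]]; auto.
        - right. simpl. now rewrite Rmult_0_l, Rplus_0_r.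
        - destruct (Rlt_dec rho (r0 + INR n * / M)) as [L|L]; [left; eauto|].
          right. replace (r0 + INR (S n) * / M) with (r0 + INR n * / M + / M) by (rewrite S_INR; ring).
          apply represents_grow with rho; auto. split; [|lra].
          assert (0 <= INR n * / M) by (apply Rmult_le_pos; [apply pos_INR|lra]). lra. }
      destruct (nfloor_ex (rho * M)) as [n Hn]; [apply Rmult_le_pos; lra|].
      destruct (step (S n)) as [E|E]; auto.
      exists (r0 + INR (S n) * / M). split; auto.
      assert (rho < INR (S n) * / M); [|lra].
      apply (Rmult_lt_reg_r M); auto. rewrite Rmult_assoc, Rinv_l, Rmult_1_r, S_INR by lra. lra. }
  exists c. split.
  - intros r Hr. destruct (main ((1 + r) / 2)) as [r' [Hr' [A _]]]; [lra|]. apply A; lra.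
  - intros z Hz. unfold unit_disc in Hz. pose proof (Cmod_ge_0 z).
    destruct (main ((1 + Cmod z) / 2)) as [r' [Hr' [_ B]]]; [lra|]. apply B; lra.
Qed.

(** * Hadamard products of functions with positive real part *)

Lemma expands_continuous f z l : expands f z l ->
  forall eps, 0 < eps -> exists d, 0 < d /\ forall z', Cmod (z' - z)%C < d -> Cmod (f z' - f z)%C < eps.
Proof.
  intros [K [s [Hs [HK H]]]] eps He.
  pose proof (Cmod_ge_0 l) as Hl.
  set (d := Rmin (Rmin s 1) (eps / (Cmod l + K + 1))).
  assert (D0 : 0 < eps / (Cmod l + K + 1)) by (apply Rdiv_lt_0_compat; lra).
  assert (D1 : d <= s) by (eapply Rle_trans; [apply Rmin_l|apply Rmin_l]).
  assert (D2 : d <= 1) by (eapply Rle_trans; [apply Rmin_l|apply Rmin_r]).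
  assert (D3 : d <= eps / (Cmod l + K + 1)) by apply Rmin_r.
  exists d. split; [repeat apply Rmin_glb_lt; lra|].
  intros z' Hz'. set (w := (z' - z)%C) in *.
  replace z' with (z + w)%C by (unfold w; ring).
  pose proof (Cmod_ge_0 w) as Hw.
  replace (f (z + w) - f z)%C with ((f (z + w) - f z - l * w) + l * w)%C by ring.
  eapply Rle_lt_trans; [apply Cmod_triangle|]. rewrite Cmod_mult.
  apply Rle_lt_trans with ((Cmod l + K) * Cmod w).
  - assert (Cmod w ^ 2 <= Cmod w) by nra.
    assert (K * Cmod w ^ 2 <= K * Cmod w) by (apply Rmult_le_compat_l; lra).
    specialize (H w ltac:(lra)). lra.
  - apply Rle_lt_trans with ((Cmod l + K) * (eps / (Cmod l + K + 1))).
    + apply Rmult_le_compat_l; lra.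
    + apply Rlt_le_trans with ((Cmod l + K + 1) * (eps / (Cmod l + K + 1))); [nra|].
      right; field; lra.
Qed.

(** Compactness makes positivity uniform on a smaller disc; this margin survives the passage to the
    limit of averages. *)
Lemma Re_lower_bound q beta rho : conv_disc q -> rho < 1 ->
  (forall z, unit_disc z -> beta < Re (PS q z)) ->
  exists m, 0 < m /\ forall z, Cmod z <= rho -> m <= Re (PS q z) - beta.
Proof.
  intros Hq Hrho H.
  destruct (disc_uniform (fun z M => / M <= Re (PS q z) - beta) rho) as [M [HM HQ]].
  - intros z M M' HM HMM' HQ. eapply Rle_trans; [|exact HQ]. now apply Rinv_le_contravar.
  - intros z Hz. assert (Dz : unit_disc z) by (unfold unit_disc; lra).
    pose proof (H z Dz) as Hp. set (e := Re (PS q z) - beta).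
    assert (He : 0 < e) by (unfold e; lra).
    destruct (expands_continuous (PS q) z _ (conv_disc_expands (PS q) q z Hq ltac:(auto) Dz) (e / 2))
      as [d [Hd Hc]]; [lra|].
    exists (2 / e), d. split; [apply Rdiv_lt_0_compat; lra|]. split; auto.
    intros z' _ Hz'. specialize (Hc z' Hz').
    pose proof (re_le_Cmod (PS q z' - PS q z)%C) as B.
    change (Re (PS q z' - PS q z)%C) with (Re (PS q z') - Re (PS q z)) in B.
    apply Rabs_le_between in B. replace (/ (2 / e)) with (e / 2) by (field; lra). unfold e in *. lra.
  - exists (/ M). split; auto. now apply Rinv_0_lt_compat.
Qed.

Lemma Clim_Re u l : Clim u l -> is_lim_seq (fun n => Re (u n)) (Re l).
Proof. intros H. now apply Clim_Re_Im in H. Qed.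

Lemma Clim_Cmod u l : Clim u l -> is_lim_seq (fun n => Cmod (u n)) (Cmod l).
Proof.
  intros H. apply is_lim_seq_ext with (fun n => (Cmod (u n) - Cmod l) + Cmod l); [intros; ring|].
  replace (Finite (Cmod l)) with (Finite (0 + Cmod l)) by (f_equal; ring).
  apply is_lim_seq_plus'; [|apply is_lim_seq_const].
  apply is_lim_seq_abs_0, is_lim_seq_squeeze0 with (2 := H).
  intros n. split; [apply Rabs_pos|]. apply Rabs_le.
  assert (A : Cmod (u n) <= Cmod (u n - l) + Cmod l).
  { replace (u n) with ((u n - l) + l)%C at 1 by ring. apply Cmod_triangle. }
  assert (B : Cmod l <= Cmod (u n - l) + Cmod (u n)).
  { replace l with (- (u n - l) + u n)%C at 1 by ring. rewrite <- (Cmod_opp (u n - l)). apply Cmod_triangle. }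
  lra.
Qed.

Lemma PS_conj q z : summable (fun n => q n * z ^ n)%C ->
  PS (fun n => Cconj (q n)) (Cconj z) = Cconj (PS q z).
Proof.
  intros H. unfold PS. rewrite <- C_Series_conj by auto.
  apply C_Series_ext. intros n. now rewrite Cmult_conj, Cpow_conj.
Qed.

(* On the circle 2 Re P Re Q = Re (P Q) + Re (P conj Q); pairing zeta with conj zeta makes the
   first term average to the Hadamard product and the second one to p_0 conj q_0 = 1. *)
Lemma average_of_product p q al be : summable p -> summable q ->
  p 0%nat = RtoC 1 -> q 0%nat = RtoC 1 ->
  is_lim_seq (fun N => ravg N (fun z => (Re (PS p z) - al) * (Re (PS q (Cconj z)) - be)))
    ((Re (C_Series (fun n => p n * q n)%C) - (1 - 2 * (1 - al) * (1 - be))) / 2).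
Proof.
  intros Hp Hq p0 q0.
  (* The conjugate of Q(conj z) is again a power series in z, with coefficients [qc], so its product
     with P is averaged by the mean value property. *)
  set (qc := fun n => Cconj (q n)).
  assert (Hqc : summable qc).
  { apply ex_series_ext with (2 := Hq). intros n. unfold qc. now rewrite Cmod_conj. }
  assert (qc0 : qc 0%nat = RtoC 1).
  { unfold qc. rewrite q0. unfold Cconj, RtoC; simpl. now rewrite Ropp_0. }
  assert (Eq : forall z, Cmod z = 1 -> PS q (Cconj z) = Cconj (PS qc z)).
  { intros z Hz. replace z with (Cconj (Cconj z)) at 2 by apply Cconj_conj.
    unfold qc. rewrite PS_conj, Cconj_conj; auto.
    apply summable_circle; auto. now rewrite Cmod_conj. }
  assert (L1 := Clim_Re _ _ (avg_mult_conj p q Hp Hq)).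
  assert (L2 := Clim_Re _ _ (avg_mult p qc Hp Hqc)).
  assert (L3 := Clim_Re _ _ (avg_PS p Hp)).
  assert (L4 := Clim_Re _ _ (avg_PS qc Hqc)).
  rewrite p0, qc0, Cmult_1_r in L2. rewrite p0 in L3. rewrite qc0 in L4.
  rewrite re_RtoC in L2, L3, L4.
  (* The constants collect to 1/2 - al - be + al be = (2 (1 - al)(1 - be) - 1) / 2, which is the
     origin of gamma. *)
  replace (Finite ((Re (C_Series (fun n => p n * q n)%C) - (1 - 2 * (1 - al) * (1 - be))) / 2))
    with (Finite ((/ 2 * Re (C_Series (fun n => p n * q n)%C) + / 2 * 1)
                   + ((- be * 1 + - al * 1) + al * be))) by (f_equal; field).
  apply is_lim_seq_ext with (fun N =>
     (/ 2 * Re (avg N (fun z => PS p z * PS q (Cconj z))%C) + / 2 * Re (avg N (fun z => PS p z * PS qc z)%C))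
     + ((- be * Re (avg N (PS p)) + - al * Re (avg N (PS qc))) + al * be)).
  - intros N. rewrite !Re_avg, <- (ravg_const N (al * be)), <- !ravg_scal, <- !ravg_plus.
    apply ravg_ext. intros z Hz. rewrite Eq by auto. rewrite !re_mult, re_conj, im_conj. field.
  - repeat (apply is_lim_seq_plus'); try apply is_lim_seq_const;
      apply is_lim_seq_mult'; auto using is_lim_seq_const.
Qed.

Definition hprod (c d : nat -> C) (n : nat) : C := (c n * d n)%C.

(** With L the limit of the averages, Re - gamma equals 2 L. The limit gives L >= |p2 * q2| only
    weakly, but also L > 0, and together these make 2 L strictly larger. *)
Lemma hadamard_positive p p2 q q2 al be :
  al < 1 -> conv_disc p -> conv_disc p2 -> conv_disc q -> conv_disc q2 ->
  p 0%nat = RtoC 1 -> q 0%nat = RtoC 1 ->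
  (forall z, unit_disc z -> Re (PS p z) - al > Cmod (PS p2 z)) ->
  (forall z, unit_disc z -> Re (PS q z) - be > Cmod (PS q2 z)) ->
  forall z, unit_disc z ->
    Re (PS (hprod p q) z) - (1 - 2 * (1 - al) * (1 - be)) > Cmod (PS (hprod p2 q2) z).
Proof.
  intros Hal Hp Hp2 Hq Hq2 p0 q0 Hu Hv z0 Hz0. unfold unit_disc in Hz0.
  pose proof (Cmod_ge_0 z0) as Hpos.
  (* Any a with |z0| < a < 1 splits z0 = a b with both moduli below 1; the midpoint also covers z0 =
     0. *)
  set (a := (1 + Cmod z0) / 2). set (b := (z0 / RtoC a)%C).
  assert (Ha : 0 < a < 1) by (unfold a; lra).
  assert (a0 : RtoC a <> RtoC 0) by (intros E; apply RtoC_inj in E; lra).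
  assert (Ma : Cmod (RtoC a) = a) by (rewrite Cmod_R; apply Rabs_pos_eq; lra).
  assert (Mb : Cmod b < 1).
  { unfold b. rewrite Cmod_div, Ma by auto. apply Rlt_div_l; [lra|]. unfold a; lra. }
  pose proof (Cmod_ge_0 b) as Hb.
  set (P := fun n => (p n * RtoC a ^ n)%C). set (P2 := fun n => (p2 n * RtoC a ^ n)%C).
  set (Q := fun n => (q n * b ^ n)%C). set (Q2 := fun n => (q2 n * b ^ n)%C).
  assert (SP : summable P) by (apply (absc_summable p a); [apply Hp; lra|lra]).
  assert (SP2 : summable P2) by (apply (absc_summable p2 a); [apply Hp2; lra|lra]).
  assert (SQ : summable Q) by (apply (absc_summable q (Cmod b)); [apply Hq; lra|lra]).
  assert (SQ2 : summable Q2) by (apply (absc_summable q2 (Cmod b)); [apply Hq2; lra|lra]).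
  assert (prod : forall c d : nat -> C,
    C_Series (fun n => (c n * RtoC a ^ n) * (d n * b ^ n))%C = PS (hprod c d) z0).
  { intros c d. apply C_Series_ext. intros n. unfold hprod.
    replace z0 with (RtoC a * b)%C by (unfold b; field; auto). rewrite Cpow_mult_l. ring. }
  assert (P0 : P 0%nat = RtoC 1) by (unfold P; rewrite p0; simpl; ring).
  assert (Q0 : Q 0%nat = RtoC 1) by (unfold Q; rewrite q0; simpl; ring).
  assert (Lim : is_lim_seq (fun N => ravg N (fun z => (Re (PS P z) - al) * (Re (PS Q (Cconj z)) - be)))
    ((Re (PS (hprod p q) z0) - (1 - 2 * (1 - al) * (1 - be))) / 2)).
  { rewrite <- prod. now apply average_of_product. }
  set (L := (Re (PS (hprod p q) z0) - (1 - 2 * (1 - al) * (1 - be))) / 2) in *.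
  assert (U : forall z, Cmod z = 1 -> Cmod (PS P2 z) < Re (PS P z) - al).
  { intros z Hz. unfold P, P2. rewrite !PS_scale. apply Hu. unfold unit_disc.
    rewrite Cmod_mult, Ma, Hz. lra. }
  assert (V : forall z, Cmod z = 1 -> Cmod (PS Q2 (Cconj z)) < Re (PS Q (Cconj z)) - be).
  { intros z Hz. unfold Q, Q2. rewrite !PS_scale. apply Hv. unfold unit_disc.
    rewrite Cmod_mult, Cmod_conj, Hz. lra. }
  assert (T : Cmod (PS (hprod p2 q2) z0) <= L).
  { rewrite <- prod. fold P2 Q2.
    assert (K := Clim_Cmod _ _ (avg_mult_conj P2 Q2 SP2 SQ2)).
    eapply (is_lim_seq_le _ _ (Finite _) (Finite _)); [|exact K|exact Lim].
    intros N. eapply Rle_trans; [apply Cmod_avg_le|]. apply ravg_le. intros z Hz.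
    rewrite Cmod_mult. apply Rmult_le_compat; try apply Cmod_ge_0; apply Rlt_le; auto. }
  destruct (Re_lower_bound q be (Cmod b) Hq Mb) as [m [Hm Hmin]].
  { intros z Hz. specialize (Hv z Hz). pose proof (Cmod_ge_0 (PS q2 z)). lra. }
  (* Bounding the second factor below by m leaves the average of Re P - al, which tends to 1 -
     al. *)
  assert (Lpos : m * (1 - al) <= L).
  { assert (L3 := Clim_Re _ _ (avg_PS P SP)). rewrite P0, re_RtoC in L3.
    apply (is_lim_seq_le (fun N => m * (Re (avg N (PS P)) - al))
       (fun N => ravg N (fun z => (Re (PS P z) - al) * (Re (PS Q (Cconj z)) - be)))
       (Finite (m * (1 - al))) (Finite L)); [|apply is_lim_seq_mult';
         [apply is_lim_seq_const|apply is_lim_seq_minus'; auto using is_lim_seq_const]|exact Lim].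
    intros N. rewrite Re_avg. unfold Rminus at 1. rewrite <- (ravg_const N (- al)), <- ravg_plus, <- ravg_scal.
    apply ravg_le. intros z Hz. rewrite Rmult_comm.
    apply Rmult_le_compat_l.
    - specialize (U z Hz). pose proof (Cmod_ge_0 (PS P2 z)). lra.
    - unfold Q. rewrite PS_scale. apply Hmin. rewrite Cmod_mult, Cmod_conj, Hz. lra. }
  assert (0 < m * (1 - al)) by (apply Rmult_lt_0_compat; lra).
  unfold L in *. lra.
Qed.

(** Split r as sqrt r times sqrt r: at radius sqrt r < 1 one factor is bounded and the other
    summable. *)
Lemma hprod_conv_disc c d : conv_disc c -> conv_disc d -> conv_disc (hprod c d).
Proof.
  intros Hc Hd r Hr.
  assert (S1 : sqrt r < 1) by (rewrite <- sqrt_1; apply sqrt_lt_1; lra).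
  assert (S0 := sqrt_pos r).
  destruct (absc_bounded c (sqrt r) S0 (Hc (sqrt r) (conj S0 S1))) as [M HM].
  apply (ex_series_dom _ (fun n => M * (Cmod (d n) * sqrt r ^ n))).
  - intros n. unfold hprod. rewrite Cmod_mult.
    rewrite <- (sqrt_sqrt r) at 1 by lra. rewrite Rpow_mult_distr.
    replace (Cmod (c n) * Cmod (d n) * (sqrt r ^ n * sqrt r ^ n))
      with ((Cmod (c n) * sqrt r ^ n) * (Cmod (d n) * sqrt r ^ n)) by ring.
    assert (P : forall e : nat -> C, 0 <= Cmod (e n) * sqrt r ^ n)
      by (intros; apply Rmult_le_pos; [apply Cmod_ge_0|now apply pow_le]).
    rewrite Rabs_pos_eq by (apply Rmult_le_pos; apply P).
    apply Rmult_le_compat_r; [apply P|apply HM].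
  - apply (ex_series_scal M (fun n => Cmod (d n) * sqrt r ^ n)). apply Hd; lra.
Qed.

(** * The classes of harmonic maps in terms of coefficients *)

Lemma unit_disc_0 : unit_disc 0.
Proof. unfold unit_disc. rewrite Cmod_0. lra. Qed.

Lemma dser_0 c : dser c 0%nat = c 1%nat.
Proof. unfold dser. simpl. ring. Qed.

Section PowerSeriesOnDisc.

Context (h : C -> C) (c : nat -> C) (Hc : conv_disc c).
Context (H : forall z, unit_disc z -> h z = PS c z).

Lemma C_derive_PS z : unit_disc z -> C_derive h z = PS (dser c) z.
Proof. intros Hz. now apply expands_C_derive, conv_disc_expands. Qed.

Lemma PS_value_0 : h 0 = c 0%nat.
Proof. rewrite H by apply unit_disc_0. apply PS_0. Qed.

Lemma C_derive_PS_0 : C_derive h 0 = c 1%nat.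
Proof. rewrite C_derive_PS by apply unit_disc_0. now rewrite PS_0, dser_0. Qed.

Lemma quot_id_PS z : c 0%nat = RtoC 0 -> unit_disc z ->
  quot_id h z = PS (fun n => c (S n)) z.
Proof.
  intros c0 Hz. unfold quot_id. destruct (Ceq_dec z 0) as [->|nz].
  - now rewrite C_derive_PS_0, PS_0.
  - rewrite H by auto. unfold unit_disc in Hz.
    assert (0 < Cmod z) by now apply Cmod_gt_0.
    rewrite (PS_S c (Cmod z)), c0; auto; try lra.
    + field. auto.
    + apply Hc. lra.
Qed.

Lemma conv_disc_S : conv_disc (fun n => c (S n)).
Proof.
  intros r Hr. apply absc_le with ((1 + r) / 2); [lra|]. apply absc_S; [lra|]. apply Hc; lra.
Qed.

End PowerSeriesOnDisc.

Lemma class_H0_PS f a b : conv_disc a -> conv_disc b ->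
  (forall z, unit_disc z -> hpart f z = PS a z) -> (forall z, unit_disc z -> gpart f z = PS b z) ->
  (class_H0 f <-> a 0%nat = RtoC 0 /\ a 1%nat = RtoC 1 /\ b 0%nat = RtoC 0 /\ b 1%nat = RtoC 0).
Proof.
  intros Ha Hb Hf Hg. unfold class_H0.
  rewrite (PS_value_0 (hpart f) a), (PS_value_0 (gpart f) b),
    (C_derive_PS_0 (hpart f) a), (C_derive_PS_0 (gpart f) b) by auto.
  split; [tauto|]. intros E. split; [now apply conv_disc_analytic with a|].
  split; [now apply conv_disc_analytic with b|]. tauto.
Qed.

Lemma class_H0_coefs f : class_H0 f -> exists a b, conv_disc a /\ conv_disc b /\
  (forall z, unit_disc z -> hpart f z = PS a z) /\ (forall z, unit_disc z -> gpart f z = PS b z) /\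
  a 0%nat = RtoC 0 /\ a 1%nat = RtoC 1 /\ b 0%nat = RtoC 0 /\ b 1%nat = RtoC 0.
Proof.
  intros Hf. destruct (analytic_on_disc_PS _ (proj1 Hf)) as [a [Ha Hfa]].
  destruct (analytic_on_disc_PS _ (proj1 (proj2 Hf))) as [b [Hb Hfb]].
  exists a, b. repeat (split; [assumption|]). now apply (class_H0_PS f a b).
Qed.

Lemma hadamard_tail_PS h k c d z : conv_disc c -> conv_disc d ->
  (forall z, unit_disc z -> h z = PS c z) -> (forall z, unit_disc z -> k z = PS d z) ->
  unit_disc z -> hprod c d 0%nat = RtoC 0 ->
  PS (hprod c d) z = (hprod c d 1%nat * z + hadamard_tail h k z)%C.
Proof.
  intros Hc Hd Hh Hk Hz E.
  assert (Hs : summable (fun n => hprod c d n * z ^ n)%C).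
  { apply (absc_summable _ (Cmod z)); [|lra]. apply hprod_conv_disc; auto.
    split; [apply Cmod_ge_0|exact Hz]. }
  unfold PS. rewrite C_Series_S by exact Hs.
  rewrite (C_Series_S (fun n => hprod c d (S n) * z ^ S n)%C)
    by exact (proj1 (summable_S (fun n => hprod c d n * z ^ n)%C) Hs).
  replace (hadamard_tail h k z) with (C_Series (fun n => hprod c d (S (S n)) * z ^ S (S n))%C).
  - rewrite E. simpl. ring.
  - apply C_Series_ext. intros n. cbv zeta.
    rewrite (taylor_coef_PS h c), (taylor_coef_PS k d) by auto.
    replace (n + 2)%nat with (S (S n)) by lia. reflexivity.
Qed.

Lemma harmonic_conv_PH0 alpha beta f F : alpha < 1 ->
  class_PH0 alpha f -> class_GH0 beta F ->
  class_PH0 (1 - 2 * (1 - alpha) * (1 - beta)) (harmonic_conv f F).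
Proof.
  intros Hal [Hf Pf] [HF GF].
  destruct (class_H0_coefs f Hf) as [a [b [ca [cb [fa [fb [a0 [a1 [b0 b1]]]]]]]]].
  destruct (class_H0_coefs F HF) as [A [B [cA [cB [FA [FB [A0 [A1 [B0 B1]]]]]]]]].
  assert (e0 : hprod a A 0%nat = RtoC 0) by (unfold hprod; rewrite a0; ring).
  assert (e1 : hprod a A 1%nat = RtoC 1) by (unfold hprod; rewrite a1, A1; ring).
  assert (e2 : hprod b B 0%nat = RtoC 0) by (unfold hprod; rewrite b0; ring).
  assert (e3 : hprod b B 1%nat = RtoC 0) by (unfold hprod; rewrite b1; ring).
  assert (Hh : forall z, unit_disc z -> hpart (harmonic_conv f F) z = PS (hprod a A) z).
  { intros z Hz. rewrite (hadamard_tail_PS (hpart f) (hpart F) a A), e1 by auto. simpl. ring. }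
  assert (Hg : forall z, unit_disc z -> gpart (harmonic_conv f F) z = PS (hprod b B) z).
  { intros z Hz. rewrite (hadamard_tail_PS (gpart f) (gpart F) b B), e3 by auto. simpl. ring. }
  assert (cH := hprod_conv_disc a A ca cA). assert (cG := hprod_conv_disc b B cb cB).
  (* The factor n goes entirely to the first sequence: h' comes from f, and the shifted sequence is
     that of H(z)/z. *)
  assert (dprod : forall u v, dser (hprod u v) = hprod (dser u) (fun n => v (S n))).
  { intros u v. apply functional_extensionality. intros n. unfold dser, hprod. ring. }
  split.
  - apply (class_H0_PS _ (hprod a A) (hprod b B)); auto.
  - intros z Hz. rewrite (C_derive_PS (hpart (harmonic_conv f F)) (hprod a A)),
      (C_derive_PS (gpart (harmonic_conv f F)) (hprod b B)), !dprod by auto.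
    change (Re (PS (hprod (dser a) (fun n => A (S n))) z - RtoC (1 - 2 * (1 - alpha) * (1 - beta)))%C)
      with (Re (PS (hprod (dser a) (fun n => A (S n))) z) - (1 - 2 * (1 - alpha) * (1 - beta))).
    apply hadamard_positive; auto using dser_conv_disc, conv_disc_S.
    + now rewrite dser_0.
    + intros w Hw. specialize (Pf w Hw).
      rewrite (C_derive_PS (hpart f) a), (C_derive_PS (gpart f) b) in Pf by auto. exact Pf.
    + intros w Hw. specialize (GF w Hw).
      rewrite (quot_id_PS (hpart F) A), (quot_id_PS (gpart F) B) in GF by auto. exact GF.
Qed.

(** * Strict monotonicity *)

Definition dot (x y : C) : R := Re x * Re y + Im x * Im y.

Lemma dot_self x : dot x x = Cmod x ^ 2.
Proof. rewrite Cmod2_alt. unfold dot. ring. Qed.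

Lemma dot_Re x y : dot x y = Re (x * Cconj y)%C.
Proof. rewrite re_mult, re_conj, im_conj. unfold dot. ring. Qed.

Lemma dot_le_Cmod x y : Rabs (dot x y) <= Cmod x * Cmod y.
Proof. rewrite dot_Re, <- (Cmod_conj y), <- Cmod_mult. apply re_le_Cmod. Qed.

Lemma unit_disc_segment z w t : unit_disc z -> unit_disc w -> 0 <= t <= 1 ->
  unit_disc (w + RtoC t * (z - w))%C.
Proof.
  unfold unit_disc. intros Hz Hw Ht.
  replace (w + RtoC t * (z - w))%C with (RtoC (1 - t) * w + RtoC t * z)%C by (rewrite RtoC_minus; ring).
  eapply Rle_lt_trans; [apply Cmod_triangle|].
  rewrite !Cmod_mult, !Cmod_R, !Rabs_pos_eq by lra.
  set (m := Rmax (Cmod z) (Cmod w)).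
  assert (Hm : m < 1) by now apply Rmax_lub_lt.
  assert ((1 - t) * Cmod w <= (1 - t) * m) by (apply Rmult_le_compat_l; [lra|apply Rmax_r]).
  assert (t * Cmod z <= t * m) by (apply Rmult_le_compat_l; [lra|apply Rmax_l]). lra.
Qed.

Lemma real_derive_quadratic (phi : R -> R) t l K s : 0 < s -> 0 <= K ->
  (forall e, Rabs e < s -> Rabs (phi (t + e) - phi t - l * e) <= K * e ^ 2) -> is_derive phi t l.
Proof.
  intros Hs HK H. apply is_derive_Reals. intros eps He.
  assert (Hd : 0 < Rmin s (eps / (K + 1))).
  { apply Rmin_glb_lt; auto. apply Rdiv_lt_0_compat; lra. }
  exists (mkposreal _ Hd). intros e He0 Hed. simpl in Hed.
  assert (H1 : Rabs e < s) by (eapply Rlt_le_trans; [exact Hed|apply Rmin_l]).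
  assert (H2 : Rabs e < eps / (K + 1)) by (eapply Rlt_le_trans; [exact Hed|apply Rmin_r]).
  specialize (H e H1).
  replace ((phi (t + e) - phi t) / e - l) with ((phi (t + e) - phi t - l * e) / e) by (field; auto).
  assert (He1 : 0 < Rabs e) by now apply Rabs_pos_lt.
  unfold Rdiv. rewrite Rabs_mult, Rabs_inv. apply Rlt_div_l; [auto|].
  eapply Rle_lt_trans; [exact H|].
  rewrite <- pow2_abs. replace (K * Rabs e ^ 2) with (K * Rabs e * Rabs e) by ring.
  apply Rmult_lt_compat_r; auto.
  apply Rle_lt_trans with (K * (eps / (K + 1))); [apply Rmult_le_compat_l; lra|].
  apply Rlt_le_trans with ((K + 1) * (eps / (K + 1))).
  - apply Rmult_lt_compat_r; [apply Rdiv_lt_0_compat|]; lra.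
  - right; field; lra.
Qed.

Definition analytic_pair (f : harmonic_map) : Prop :=
  forall z, unit_disc z -> expands (hpart f) z (C_derive (hpart f) z) /\
    expands (gpart f) z (C_derive (gpart f) z).

Lemma class_H0_analytic_pair f : class_H0 f -> analytic_pair f.
Proof.
  intros Hf z Hz. destruct (class_H0_coefs f Hf) as [a [b [ca [cb [fa [fb _]]]]]].
  rewrite (C_derive_PS (hpart f) a), (C_derive_PS (gpart f) b) by auto.
  split; now apply conv_disc_expands.
Qed.

(** The conjugated part is not complex differentiable, so f is differentiated along a real line.
    Pairing with D turns the two quadratic remainders into one bounded by (K1 + K2) |D|^3 e^2. *)
Lemma directional_derivative f w D t : analytic_pair f -> unit_disc (w + RtoC t * D)%C ->
  is_derive (fun t => dot (f (w + RtoC t * D)%C) D) t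
    (dot (C_derive (hpart f) (w + RtoC t * D) * D + Cconj (C_derive (gpart f) (w + RtoC t * D) * D))%C D).
Proof.
  intros Hf Hz. set (z := (w + RtoC t * D)%C) in *.
  destruct (Hf z Hz) as [[K1 [s1 [Hs1 [HK1 E1]]]] [K2 [s2 [Hs2 [HK2 E2]]]]].
  set (dh := C_derive (hpart f) z) in *. set (dg := C_derive (gpart f) z) in *.
  assert (HD := Cmod_ge_0 D).
  apply real_derive_quadratic with ((K1 + K2) * Cmod D ^ 3) (Rmin s1 s2 / (Cmod D + 1)).
  - apply Rdiv_lt_0_compat; [now apply Rmin_glb_lt|lra].
  - apply Rmult_le_pos; [lra|now apply pow_le].
  - intros e He. apply Rlt_div_r in He; [|lra].
    assert (M : Cmod (RtoC e * D) = Rabs e * Cmod D) by now rewrite Cmod_mult, Cmod_R.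
    assert (Hpe := Rabs_pos e).
    assert (L1 : Cmod (RtoC e * D) < s1) by (rewrite M; pose proof (Rmin_l s1 s2); nra).
    assert (L2 : Cmod (RtoC e * D) < s2) by (rewrite M; pose proof (Rmin_r s1 s2); nra).
    specialize (E1 _ L1). specialize (E2 _ L2).
    set (r1 := (hpart f (z + RtoC e * D) - hpart f z - dh * (RtoC e * D))%C) in *.
    set (r2 := (gpart f (z + RtoC e * D) - gpart f z - dg * (RtoC e * D))%C) in *.
    cbv beta. fold z.
    replace (dot (f (w + RtoC (t + e) * D)%C) D - dot (f z) D - dot (dh * D + Cconj (dg * D))%C D * e)
      with (dot (r1 + Cconj r2)%C D).
    + eapply Rle_trans; [apply dot_le_Cmod|].
      replace ((K1 + K2) * Cmod D ^ 3 * e ^ 2)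
        with ((K1 * Cmod (RtoC e * D) ^ 2 + K2 * Cmod (RtoC e * D) ^ 2) * Cmod D).
      * apply Rmult_le_compat_r; auto. eapply Rle_trans; [apply Cmod_triangle|].
        rewrite Cmod_conj. lra.
      * rewrite M, Rpow_mult_distr, pow2_abs. ring.
    + replace (w + RtoC (t + e) * D)%C with (z + RtoC e * D)%C by (unfold z; rewrite RtoC_plus; ring).
      unfold harmonic_fun, r1, r2, dot, Cconj, Cminus, Cplus, Copp, Cmult, RtoC, Re, Im; simpl. ring.
Qed.

Definition monotone_on_disc (f : C -> C) : Prop :=
  forall z w, unit_disc z -> unit_disc w -> z <> w -> 0 < dot (f z - f w)%C (z - w)%C.

(** Mean value theorem on the segment from w to z: with D = z - w, the derivative of the pairing is
    at least (Re h' - |g'|) |D|^2, which is positive. *)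
Lemma PH0_monotone f : class_PH0 0 f -> monotone_on_disc f.
Proof.
  intros [Hf Pf] z w Hz Hw ne. set (D := (z - w)%C).
  assert (HD : 0 < Cmod D) by (apply Cmod_gt_0, Cminus_eq_contra; auto).
  set (phi := fun t => dot (f (w + RtoC t * D)%C) D).
  set (dphi := fun t => dot (C_derive (hpart f) (w + RtoC t * D) * D
      + Cconj (C_derive (gpart f) (w + RtoC t * D) * D))%C D).
  assert (der : forall t, 0 <= t <= 1 -> is_derive phi t (dphi t)).
  { intros t Ht. apply directional_derivative; [now apply class_H0_analytic_pair|].
    now apply unit_disc_segment. }
  destruct (MVT_gen phi 0 1 dphi) as [t [Ht E]].
  - rewrite Rmin_left, Rmax_right by lra. intros t Ht. apply der; lra.
  - rewrite Rmin_left, Rmax_right by lra. intros t Ht.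
    apply continuity_pt_filterlim, (ex_derive_continuous phi). eexists. apply der; lra.
  - rewrite Rmin_left, Rmax_right in Ht by lra.
    replace (dot (f z - f w)%C D) with (phi 1 - phi 0).
    + rewrite E, Rminus_0_r, Rmult_1_r. unfold dphi.
      set (u := (w + RtoC t * D)%C). assert (Hu : unit_disc u) by now apply unit_disc_segment.
      specialize (Pf u Hu). set (dh := C_derive (hpart f) u) in *. set (dg := C_derive (gpart f) u) in *.
      rewrite dot_Re, Cmult_plus_distr_r, re_plus.
      replace (dh * D * Cconj D)%C with (dh * RtoC (Cmod D ^ 2)%R)%C
        by (rewrite Cmod2_conj; ring).
      rewrite re_scal_r.
      assert (B := re_le_Cmod (Cconj (dg * D) * Cconj D)%C).
      rewrite Cmod_mult, !Cmod_conj, Cmod_mult in B. apply Rabs_le_between in B.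
      change (Re (dh - RtoC 0)%C) with (Re dh - 0) in Pf.
      assert (0 < Cmod D ^ 2) by now apply pow_lt.
      assert (Cmod dg * Cmod D * Cmod D < Re dh * Cmod D ^ 2); [|lra].
      replace (Cmod dg * Cmod D * Cmod D) with (Cmod dg * Cmod D ^ 2) by ring.
      apply Rmult_lt_compat_r; lra.
    + unfold phi, D. replace (w + 1 * (z - w))%C with z by ring.
      replace (w + 0 * (z - w))%C with w by ring.
      unfold dot, Cminus, Cplus, Copp, Re, Im; simpl; ring.
Qed.

(** * Variational inequalities for monotone maps *)

Ltac dot_ring := unfold dot, Cminus, Cplus, Copp, Cmult, RtoC, Re, Im; simpl; ring.

(** If the infimum were not attained, the excess of Phi over it would be positive on the disc, hence
    at least some 1 / M by compactness, contradicting the infimum. *)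
Lemma disc_min (Phi : C -> R) : (forall z, 0 <= Phi z) ->
  (forall z eps, 0 < eps -> exists d, 0 < d /\ forall z', Cmod (z' - z)%C < d -> Phi z < Phi z' + eps) ->
  exists z, Cmod z <= 1 /\ forall z', Cmod z' <= 1 -> Phi z <= Phi z'.
Proof.
  intros Hpos lsc. apply NNPP. intros Hno.
  assert (H0 : Cmod 0 <= 1) by (rewrite Cmod_0; lra).
  destruct (completeness (fun y => exists z, Cmod z <= 1 /\ y = - Phi z)) as [s [Hub Hlub]].
  - exists 0. intros y [z [_ ->]]. specialize (Hpos z). lra.
  - exists (- Phi 0), 0. auto.
  - assert (lt : forall z, Cmod z <= 1 -> - s < Phi z).
    { intros z Hz. apply Rnot_le_lt. intros K. apply Hno. exists z. split; auto.
      intros z' Hz'. specialize (Hub (- Phi z')). assert (- Phi z' <= s) by (apply Hub; eauto). lra. }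
    destruct (disc_uniform (fun z M => - s + / M <= Phi z) 1) as [M [HM HQ]].
    + intros z M M' HM HMM' HQ. assert (/ M' <= / M) by now apply Rinv_le_contravar. lra.
    + intros z Hz. specialize (lt z Hz). set (e := Phi z + s).
      assert (He : 0 < e) by (unfold e; lra).
      destruct (lsc z (e / 2)) as [d [Hd Hc]]; [lra|].
      exists (2 / e), d. split; [apply Rdiv_lt_0_compat; lra|]. split; auto.
      intros z' _ Hz'. specialize (Hc z' Hz'). replace (/ (2 / e)) with (e / 2) by (field; lra).
      unfold e in *. lra.
    + assert (0 < / M) by now apply Rinv_0_lt_compat.
      assert (s <= s - / M); [|lra].
      apply Hlub. intros y [z [Hz ->]]. specialize (HQ z Hz). lra.
Qed.

Definition pospart (x : R) : R := Rmax 0 x.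

(** Convexity of the squared positive part, whose derivative is 2 [pospart x]. This bound gives
    lower semicontinuity of the penalty below, and the matching quadratic upper bound gives the
    first-order condition at its minimum. *)
Lemma pospart_sqr_tangent x y : pospart x ^ 2 + 2 * pospart x * y <= pospart (x + y) ^ 2.
Proof. unfold pospart, Rmax. destruct (Rle_dec 0 x), (Rle_dec 0 (x + y)); nra. Qed.

Lemma pospart_sqr_upper x y : pospart (x + y) ^ 2 <= pospart x ^ 2 + 2 * pospart x * y + y ^ 2.
Proof. unfold pospart, Rmax. destruct (Rle_dec 0 x), (Rle_dec 0 (x + y)); nra. Qed.

Lemma pospart_ge0 x : 0 <= pospart x.
Proof. apply Rmax_l. Qed.

Lemma pospart_mult x : pospart x * x = pospart x ^ 2.
Proof. unfold pospart, Rmax. destruct (Rle_dec 0 x); ring. Qed.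

Lemma dot_csum c f n : dot c (csum f n) = rsum (fun j => dot c (f j)) n.
Proof.
  induction n as [|n IH]; simpl; [dot_ring|]. rewrite <- IH. dot_ring.
Qed.

(* Debrunner-Flor: minimise the sum of the squared violations of the n inequalities; testing
   minimality against the barycentre of the zeta_i weighted by the violations lambda_i gives,
   by monotonicity, that all the lambda_i vanish. *)
Lemma finite_variational n (zeta c : nat -> C) :
  (forall i, (i < n)%nat -> Cmod (zeta i) <= 1) ->
  (forall i j, (i < n)%nat -> (j < n)%nat -> 0 <= dot (c i - c j)%C (zeta i - zeta j)%C) ->
  exists z, Cmod z <= 1 /\ forall i, (i < n)%nat -> 0 <= dot (c i) (zeta i - z)%C.
Proof.
  intros Hz Hmono.
  set (lam := fun z i => pospart (dot (c i) (z - zeta i)%C)).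
  set (Phi := fun z => rsum (fun i => lam z i ^ 2) n).
  assert (lam0 : forall z i, 0 <= lam z i) by (intros; apply pospart_ge0).
  destruct (disc_min Phi) as [z [Hz1 Hmin]].
  - intros z. apply rsum_ge0. intros; apply pow2_ge_0.
  - intros z eps He.
    set (B := rsum (fun i => 2 * lam z i * Cmod (c i)) n).
    assert (HB : 0 <= B).
    { apply rsum_ge0. intros. apply Rmult_le_pos; [|apply Cmod_ge_0]. specialize (lam0 z i); lra. }
    exists (eps / (B + 1)). split; [apply Rdiv_lt_0_compat; lra|]. intros z' Hz'.
    assert (T : Phi z - B * Cmod (z' - z) <= Phi z').
    { unfold Phi, B. rewrite (Rmult_comm _ (Cmod (z' - z))), <- rsum_scal, <- rsum_minus.
      apply rsum_le. intros i _.
      assert (P := pospart_sqr_tangent (dot (c i) (z - zeta i)%C) (dot (c i) (z' - z)%C)).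
      replace (dot (c i) (z - zeta i)%C + dot (c i) (z' - z)%C) with (dot (c i) (z' - zeta i)%C) in P by dot_ring.
      fold (lam z i) (lam z' i) in P.
      assert (Q := dot_le_Cmod (c i) (z' - z)%C). apply Rabs_le_between in Q.
      assert (lam z i * - (Cmod (c i) * Cmod (z' - z)%C) <= lam z i * dot (c i) (z' - z)%C)
        by (apply Rmult_le_compat_l; [apply lam0|lra]).
      lra. }
    apply Rlt_div_r in Hz'; [|lra]. pose proof (Cmod_ge_0 (z' - z)). nra.
  - exists z. split; auto.
    set (l := lam z). set (La := rsum l n).
    assert (first_order : forall y, Cmod y <= 1 -> 0 <= rsum (fun i => l i * dot (c i) (y - z)%C) n).
    { intros y Hy. set (A := rsum (fun i => l i * dot (c i) (y - z)%C) n).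
      set (B := rsum (fun i => dot (c i) (y - z)%C ^ 2) n).
      assert (HB : 0 <= B) by (apply rsum_ge0; intros; apply pow2_ge_0).
      apply Rnot_lt_le. intros HA.
      (* If the slope A were negative, this step s would give 2 s A + s^2 B < 0 and so decrease
         Phi. *)
      set (s := Rmin 1 (- A / (B + 1))).
      assert (Hs : 0 < s) by (apply Rmin_glb_lt; [lra|apply Rdiv_lt_0_compat; lra]).
      assert (s1 : s <= 1) by apply Rmin_l.
      assert (s2 : s * (B + 1) <= - A).
      { apply Rle_div_r; [lra|apply Rmin_r]. }
      assert (M : Phi z <= Phi (z + RtoC s * (y - z))%C).
      { apply Hmin. replace (z + RtoC s * (y - z))%C with (RtoC (1 - s) * z + RtoC s * y)%C
          by (rewrite RtoC_minus; ring).
        eapply Rle_trans; [apply Cmod_triangle|].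
        rewrite !Cmod_mult, !Cmod_R, !Rabs_pos_eq by lra. nra. }
      assert (U : Phi (z + RtoC s * (y - z))%C <= Phi z + 2 * s * A + s ^ 2 * B).
      { unfold Phi, A, B. rewrite <- !rsum_scal, <- !rsum_plus. apply rsum_le. intros i _.
        assert (P := pospart_sqr_upper (dot (c i) (z - zeta i)%C) (s * dot (c i) (y - z)%C)).
        replace (dot (c i) (z - zeta i)%C + s * dot (c i) (y - z)%C)
          with (dot (c i) (z + RtoC s * (y - z) - zeta i)%C) in P by dot_ring.
        fold (lam z i) in P. fold (lam (z + RtoC s * (y - z))%C i) in P. unfold l. nra. }
      nra. }
    destruct (Rle_lt_or_eq_dec 0 La) as [Lpos|L0]; [apply rsum_ge0; intros; apply lam0| |].
    + exfalso.
      assert (C0 : RtoC La <> RtoC 0) by (intros E; apply RtoC_inj in E; lra).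
      set (y := (csum (fun j => RtoC (l j) * zeta j) n / RtoC La)%C).
      assert (Hy : Cmod y <= 1).
      { unfold y. rewrite Cmod_div, Cmod_R, (Rabs_pos_eq La) by (auto; lra).
        apply Rle_div_l; [lra|]. rewrite Rmult_1_l. eapply Rle_trans; [apply Cmod_csum_le|].
        unfold La. apply rsum_le. intros i Hi. rewrite Cmod_mult, Cmod_R, Rabs_pos_eq by apply lam0.
        rewrite <- (Rmult_1_r (l i)) at 2. apply Rmult_le_compat_l; [apply lam0|auto]. }
      specialize (first_order y Hy).
      set (T := fun i j => l i * l j * dot (c i) (zeta j - z)%C).
      assert (E : La * rsum (fun i => l i * dot (c i) (y - z)%C) n = rsum (fun i => rsum (T i) n) n).
      { rewrite <- rsum_scal. apply rsum_ext. intros i _.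
        replace (La * (l i * dot (c i) (y - z)%C))
          with (l i * (dot (c i) (csum (fun j => RtoC (l j) * zeta j)%C n) - La * dot (c i) z)).
        2:{ replace (csum (fun j => RtoC (l j) * zeta j)%C n) with (RtoC La * y)%C by (unfold y; field; auto).
            dot_ring. }
        rewrite dot_csum. unfold La. rewrite (Rmult_comm (rsum l n)), <- rsum_scal, <- rsum_minus, <- rsum_scal.
        apply rsum_ext. intros j _. unfold T. dot_ring. }
      (* Adding T i j and T j i brings in the pairing of c_i - c_j with zeta_i - zeta_j, which has a
         sign; only the diagonal pairings, equal to minus squares of violations, remain. *)
      assert (S2 : rsum (fun i => rsum (T i) n) n + rsum (fun i => rsum (T i) n) n
         <= - 2 * La * rsum (fun i => l i ^ 2) n).
      { rewrite (rsum_exchange T n n) at 2. rewrite <- rsum_plus.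
        apply Rle_trans with (rsum (fun i => rsum (fun j => - (l i ^ 2) * l j + - (l j ^ 2) * l i) n) n).
        - apply rsum_le. intros i Hi. rewrite <- rsum_plus. apply rsum_le. intros j Hj. unfold T.
          assert (li : l i * dot (c i) (zeta i - z)%C = - l i ^ 2).
          { unfold l, lam. rewrite <- pospart_mult. dot_ring. }
          assert (lj : l j * dot (c j) (zeta j - z)%C = - l j ^ 2).
          { unfold l, lam. rewrite <- pospart_mult. dot_ring. }
          specialize (Hmono i j Hi Hj).
          assert (P : 0 <= l i * l j) by (apply Rmult_le_pos; apply lam0).
          replace (l i * l j * dot (c i) (zeta j - z)%C + l j * l i * dot (c j) (zeta i - z)%C)
            with ((l i * dot (c i) (zeta i - z)%C) * l j + (l j * dot (c j) (zeta j - z)%C) * l i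
                  - l i * l j * dot (c i - c j)%C (zeta i - zeta j)%C) by dot_ring.
          rewrite li, lj. assert (Q := Rmult_le_pos _ _ P Hmono). lra.
        - right. transitivity (rsum (fun i => - La * l i ^ 2 + - rsum (fun j => l j ^ 2) n * l i) n).
          + apply rsum_ext. intros i _. rewrite rsum_plus, rsum_scal.
            fold La. rewrite (rsum_ext _ (fun j => - l i * l j ^ 2)), rsum_scal by (intros; ring). ring.
          + rewrite rsum_plus, !rsum_scal. fold La. ring. }
      assert (Sq : 0 < rsum (fun i => l i ^ 2) n).
      { destruct (Rle_lt_or_eq_dec 0 (rsum (fun i => l i ^ 2) n)) as [|Z]; auto.
        - apply rsum_ge0. intros; apply pow2_ge_0.
        - exfalso. assert (La = 0); [|lra]. unfold La.
          rewrite (rsum_ext l (fun _ => 0)), rsum_const; [ring|]. intros i Hi.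
          assert (l i ^ 2 <= 0); [|nra]. rewrite Z.
          apply (rsum_term_le (fun i => l i ^ 2)); auto. intros; apply pow2_ge_0. }
      assert (0 <= La * rsum (fun i => l i * dot (c i) (y - z)%C) n) by (apply Rmult_le_pos; lra).
      nra.
    + intros i Hi. assert (li : l i <= 0).
      { rewrite L0. apply (rsum_term_le l); auto. intros; apply lam0. }
      unfold l, lam, pospart in li.
      pose proof (Rmax_r 0 (dot (c i) (z - zeta i)%C)).
      replace (dot (c i) (zeta i - z)%C) with (- dot (c i) (z - zeta i)%C) by dot_ring. lra.
Qed.

(** Minty's form: f is evaluated at the test point and not at z, so z may lie on the unit circle. *)
Definition variational_point (f : C -> C) (w z : C) : Prop :=
  forall zeta, unit_disc zeta -> 0 <= dot (f zeta - w)%C (zeta - z)%C.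

(** The points z violating the inequality for a given zeta form an open set. If every z were
    violated, finitely many zeta would account for the whole closed disc, against the finite
    version. *)
Lemma monotone_variational_point f w : monotone_on_disc f ->
  exists z, Cmod z <= 1 /\ variational_point f w z.
Proof.
  intros Hf. apply NNPP. intros Hno.
  destruct (disc_list (fun z zeta => unit_disc zeta /\ dot (f zeta - w)%C (zeta - z)%C < 0) 1) as [l Hl].
  - intros z Hz.
    assert (E : exists zeta, unit_disc zeta /\ dot (f zeta - w)%C (zeta - z)%C < 0).
    { apply NNPP. intros K. apply Hno. exists z. split; auto. intros zeta Hzeta.
      apply Rnot_lt_le. intros L. apply K. eauto. }
    destruct E as [zeta [Hzeta L]]. set (v := (f zeta - w)%C) in *.
    pose proof (Cmod_ge_0 v) as Hv.
    exists zeta, (- dot v (zeta - z)%C / (Cmod v + 1)).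
    split; [apply Rdiv_lt_0_compat; lra|].
    intros z' _ Hz'. split; [exact Hzeta|]. fold v. apply Rlt_div_r in Hz'; [|lra].
    replace (dot v (zeta - z')%C) with (dot v (zeta - z)%C - dot v (z' - z)%C) by dot_ring.
    assert (Q := dot_le_Cmod v (z' - z)%C). apply Rabs_le_between in Q.
    pose proof (Cmod_ge_0 (z' - z)). lra.
  (* Entries of l that serve no z may lie outside the disc, where monotonicity says nothing. *)
  - set (l' := filter (fun zeta => if Rlt_dec (Cmod zeta) 1 then true else false) l).
    assert (Hl' : forall i, (i < length l')%nat -> unit_disc (nth i l' 0)).
    { intros i Hi. apply (nth_In _ (RtoC 0)), filter_In in Hi. destruct Hi as [_ Hi].
      destruct (Rlt_dec (Cmod (nth i l' 0)) 1); [assumption|discriminate]. }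
    destruct (finite_variational (length l') (fun i => nth i l' 0) (fun i => (f (nth i l' 0) - w)%C))
      as [z [Hz Hi]].
    + intros i Hi. apply Rlt_le, Hl', Hi.
    + intros i j Hi Hj.
      replace (f (nth i l' 0) - w - (f (nth j l' 0) - w))%C with (f (nth i l' 0) - f (nth j l' 0))%C by ring.
      destruct (Ceq_dec (nth i l' 0) (nth j l' 0)) as [E|ne].
      * rewrite E. right. dot_ring.
      * apply Rlt_le, Hf; auto.
    + destruct (Hl z Hz) as [zeta [Hin [Hzeta L]]].
      assert (Hin' : In zeta l').
      { apply filter_In. split; auto. destruct (Rlt_dec (Cmod zeta) 1); auto. }
      destruct (In_nth l' zeta (RtoC 0) Hin') as [i [Hil Ei]].
      specialize (Hi i Hil). simpl in Hi. rewrite Ei in Hi. lra.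
Qed.

Definition continuous_on_disc (f : C -> C) : Prop :=
  forall z, unit_disc z -> forall eps, 0 < eps ->
    exists d, 0 < d /\ forall z', Cmod (z' - z)%C < d -> Cmod (f z' - f z)%C < eps.

(** Test with zeta = z - s v, where v = f z - w. If v <> 0, then for small s the pairing is close to
    -s |v|^2 by continuity, hence negative. *)
Lemma variational_point_interior f w z : continuous_on_disc f -> unit_disc z ->
  variational_point f w z -> f z = w.
Proof.
  intros Hc Hz Hv. apply NNPP. intros ne. set (v := (f z - w)%C).
  assert (Hv0 : 0 < Cmod v) by now apply Cmod_gt_0, Cminus_eq_contra.
  destruct (Hc z Hz (Cmod v) Hv0) as [d [Hd Hcont]]. unfold unit_disc in Hz.
  set (s := Rmin d (1 - Cmod z) / 2 / Cmod v).
  assert (H0 : 0 < Rmin d (1 - Cmod z)) by (apply Rmin_glb_lt; lra).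
  assert (Hs : 0 < s) by (apply Rdiv_lt_0_compat; lra).
  assert (Hsv : s * Cmod v = Rmin d (1 - Cmod z) / 2) by (unfold s; field; lra).
  pose proof (Rmin_l d (1 - Cmod z)). pose proof (Rmin_r d (1 - Cmod z)).
  set (zeta := (z - RtoC s * v)%C).
  assert (Mz : Cmod (zeta - z) = s * Cmod v).
  { replace (zeta - z)%C with (- (RtoC s * v))%C by (unfold zeta; ring).
    rewrite Cmod_opp, Cmod_mult, Cmod_R, Rabs_pos_eq; lra. }
  assert (Dz : unit_disc zeta).
  { unfold unit_disc. replace zeta with (z + (zeta - z))%C by ring.
    eapply Rle_lt_trans; [apply Cmod_triangle|]. lra. }
  specialize (Hcont zeta ltac:(lra)). specialize (Hv zeta Dz).
  assert (E : dot (f zeta - w)%C (zeta - z)%C = - s * (dot v v + dot (f zeta - f z)%C v))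
    by (unfold zeta, v; dot_ring).
  rewrite E, dot_self in Hv.
  assert (Q := dot_le_Cmod (f zeta - f z)%C v). apply Rabs_le_between in Q.
  assert (Cmod (f zeta - f z) * Cmod v < Cmod v ^ 2) by (simpl; nra).
  nra.
Qed.

(** * Half-lines filling the complement of a monotone image *)

Section Complement.

Context (f : C -> C) (Hf : monotone_on_disc f) (Hc : continuous_on_disc f).

(** For f continuous up to the circle this would say w = f(d) + t d with t >= 0: w lies on the
    half-line leaving the image of d in the direction of the outward normal to the disc at d. *)
Definition ray_direction (w d : C) : Prop := Cmod d = 1 /\ variational_point f w d.

(** Strict convexity of the disc, by the parallelogram law. *)
Lemma midpoint_in_disc a b : Cmod a <= 1 -> Cmod b <= 1 -> a <> b ->
  unit_disc (RtoC (/ 2) * (a + b))%C.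
Proof.
  intros Ha Hb ne.
  assert (H : Cmod (a + b) ^ 2 + Cmod (a - b) ^ 2 = 2 * Cmod a ^ 2 + 2 * Cmod b ^ 2)
    by (rewrite !Cmod2_alt; unfold Cminus, Cplus, Copp, Re, Im; simpl; ring).
  assert (D : 0 < Cmod (a - b)) by now apply Cmod_gt_0, Cminus_eq_contra.
  assert (A0 := Cmod_ge_0 a). assert (B0 := Cmod_ge_0 b). assert (S0 := Cmod_ge_0 (a + b)).
  unfold unit_disc. rewrite Cmod_mult, Cmod_R, Rabs_pos_eq by lra.
  assert (Cmod (a + b) < 2); [|lra]. nra.
Qed.

(** If f z0 = w, test at the midpoint m of d and z0: m - d = -(m - z0), so the inequality
    contradicts strict monotonicity between m and z0. *)
Lemma ray_direction_not_image w d : ray_direction w d -> ~ disc_image f w.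
Proof.
  intros [Hd Hv] [z0 [Hz0 E]]. unfold unit_disc in Hz0.
  assert (ne : d <> z0) by (intros K; rewrite K in Hd; lra).
  set (m := (RtoC (/ 2) * (d + z0))%C).
  assert (Hm : unit_disc m) by (apply midpoint_in_disc; auto; lra).
  assert (Em : (m - d)%C = (- (m - z0))%C).
  { unfold m. rewrite RtoC_inv by lra. field. }
  assert (nm : m <> z0).
  { intros K. apply ne. rewrite K in Em. apply Ceq_minus.
    replace (d - z0)%C with (- (z0 - d))%C by ring. rewrite Em. ring. }
  specialize (Hv m Hm). rewrite Em, <- E in Hv.
  assert (P := Hf m z0 Hm Hz0 nm).
  replace (dot (f m - f z0)%C (- (m - z0))%C) with (- dot (f m - f z0)%C (m - z0)%C) in Hv by dot_ring.
  lra.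
Qed.

Lemma ray_direction_exists w : ~ disc_image f w -> exists d, ray_direction w d.
Proof.
  intros Hw. destruct (monotone_variational_point f w Hf) as [z [Hz Hv]].
  exists z. split; auto. apply Rle_antisym; auto. apply Rnot_lt_le. intros L.
  apply Hw. exists z. split; auto. now apply variational_point_interior.
Qed.

(* Variational points form a convex set, so between two unimodular ones there is one inside
   the disc, which is then a preimage. *)
Lemma ray_direction_unique w d d' : ray_direction w d -> ray_direction w d' -> d = d'.
Proof.
  intros H H'. apply NNPP. intros ne. destruct H as [Hd Hv], H' as [Hd' Hv'].
  apply (ray_direction_not_image w d); [now split|].
  set (m := (RtoC (/ 2) * (d + d'))%C).
  assert (Hm : unit_disc m) by (apply midpoint_in_disc; auto; lra).
  exists m. split; auto. apply variational_point_interior; auto.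
  intros zeta Hz. specialize (Hv zeta Hz). specialize (Hv' zeta Hz).
  replace (dot (f zeta - w)%C (zeta - m)%C)
    with (/ 2 * dot (f zeta - w)%C (zeta - d)%C + / 2 * dot (f zeta - w)%C (zeta - d')%C)
    by (unfold m, dot, Cminus, Cplus, Copp, Cmult, RtoC, Re, Im; simpl; field).
  lra.
Qed.

Lemma dot_unit_disc_lt d zeta : Cmod d = 1 -> unit_disc zeta -> dot d (zeta - d)%C < 0.
Proof.
  unfold unit_disc. intros Hd Hz.
  replace (dot d (zeta - d)%C) with (dot d zeta - dot d d) by dot_ring.
  rewrite dot_self, Hd. assert (Q := dot_le_Cmod d zeta). rewrite Hd in Q.
  apply Rabs_le_between in Q. lra.
Qed.

(** The disc lies on one side of its tangent at d, so moving w along d increases every pairing. *)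
Lemma ray_direction_translate w d t : 0 <= t -> ray_direction w d ->
  ray_direction (w + RtoC t * d)%C d.
Proof.
  intros Ht [Hd Hv]. split; auto. intros zeta Hz. specialize (Hv zeta Hz).
  replace (dot (f zeta - (w + RtoC t * d))%C (zeta - d)%C)
    with (dot (f zeta - w)%C (zeta - d)%C - t * dot d (zeta - d)%C) by dot_ring.
  assert (K := dot_unit_disc_lt d zeta Hd Hz). nra.
Qed.

(** Nothing behind p on the line still has direction d. Without this the family would contain nested
    half-lines, which meet. *)
Definition maximal_ray (p d : C) : Prop :=
  ray_direction p d /\ forall t, 0 < t -> ~ ray_direction (p - RtoC t * d)%C d.

(** For each zeta the condition on the backward distance t is an upper bound, since the pairing of d
    with zeta - d is negative. So the admissible t are bounded, as zeta = 0 already shows, and their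
    supremum is admissible. *)
Lemma maximal_ray_exists w d : ray_direction w d ->
  exists t, 0 <= t /\ maximal_ray (w - RtoC t * d)%C d.
Proof.
  intros H. pose proof H as [Hd Hv].
  set (E := fun t => ray_direction (w - RtoC t * d)%C d).
  assert (expand : forall t zeta, dot (f zeta - (w - RtoC t * d))%C (zeta - d)%C
      = dot (f zeta - w)%C (zeta - d)%C + t * dot d (zeta - d)%C) by (intros; dot_ring).
  assert (bound : forall t zeta, unit_disc zeta -> E t ->
     t <= dot (f zeta - w)%C (zeta - d)%C / - dot d (zeta - d)%C).
  { intros t zeta Hz [_ Ht]. specialize (Ht zeta Hz). rewrite expand in Ht.
    assert (K := dot_unit_disc_lt d zeta Hd Hz). apply Rle_div_r; lra. }
  destruct (completeness E) as [T [Hub Hlub]].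
  - eexists. intros t Ht. apply (bound t (RtoC 0) unit_disc_0 Ht).
  - exists 0. red. replace (w - RtoC 0 * d)%C with w by ring. exact H.
  - exists T. assert (T0 : 0 <= T).
    { apply Hub. red. replace (w - RtoC 0 * d)%C with w by ring. exact H. }
    split; auto. split.
    + split; auto. intros zeta Hz. rewrite expand.
      assert (K := dot_unit_disc_lt d zeta Hd Hz).
      assert (B : T <= dot (f zeta - w)%C (zeta - d)%C / - dot d (zeta - d)%C)
        by (apply Hlub; intros t Ht; now apply bound).
      apply Rle_div_r in B; lra.
    + intros t Ht Hr. assert (E (T + t)).
      { red. replace (w - RtoC (T + t) * d)%C with (w - RtoC T * d - RtoC t * d)%C
          by (rewrite RtoC_plus; ring). exact Hr. }
      assert (T + t <= T) by now apply Hub. lra.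
Qed.

Lemma maximal_ray_origin w d t t' : maximal_ray (w - RtoC t * d)%C d ->
  maximal_ray (w - RtoC t' * d)%C d -> t <= t'.
Proof.
  intros [H _] [_ H']. apply Rnot_lt_le. intros L.
  apply (H' (t - t')); [lra|].
  replace (w - RtoC t' * d - RtoC (t - t') * d)%C with (w - RtoC t * d)%C
    by (rewrite RtoC_minus; ring). exact H.
Qed.

(** Two half-lines through a common point share their direction, which that point determines, and
    then their origin by maximality. *)
Lemma monotone_close_to_convex : close_to_convex (disc_image f).
Proof.
  assert (on_ray : forall p d w, maximal_ray p d -> half_line p d w -> ray_direction w d).
  { intros p d w [H _] [t [Ht ->]]. now apply ray_direction_translate. }
  exists maximal_ray. split; [now intros p d [[Hd _] _]|]. split.
  - intros p d p' d' L L' ne w [Hw Hw'].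
    assert (Ed : d = d') by (apply (ray_direction_unique w); eauto).
    subst d'. destruct Hw as [t [_ Ew]], Hw' as [t' [_ Ew']].
    assert (Ep : p = (w - RtoC t * d)%C) by (rewrite Ew; ring).
    assert (Ep' : p' = (w - RtoC t' * d)%C) by (rewrite Ew'; ring).
    apply ne. rewrite Ep in L. rewrite Ep' in L'. rewrite Ep, Ep'.
    replace t' with t; auto. apply Rle_antisym; eapply maximal_ray_origin; eauto.
  - intros w. split.
    + intros Hw. destruct (ray_direction_exists w Hw) as [d Hd].
      destruct (maximal_ray_exists w d Hd) as [t [Ht Hm]].
      exists (w - RtoC t * d)%C, d. split; auto. exists t. split; auto. ring.
    + intros [p [d [Hm Hl]]]. apply (ray_direction_not_image w d). eauto.
Qed.

End Complement.

(** * From the derivative condition to close-to-convexity, and the conclusion *)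

Lemma analytic_pair_continuous (f : harmonic_map) : analytic_pair f -> continuous_on_disc f.
Proof.
  intros Hf z Hz eps He. destruct (Hf z Hz) as [E1 E2].
  destruct (expands_continuous _ _ _ E1 (eps / 2)) as [d1 [Hd1 H1]]; [lra|].
  destruct (expands_continuous _ _ _ E2 (eps / 2)) as [d2 [Hd2 H2]]; [lra|].
  exists (Rmin d1 d2). split; [now apply Rmin_glb_lt|]. intros z' Hz'.
  specialize (H1 z' ltac:(pose proof (Rmin_l d1 d2); lra)).
  specialize (H2 z' ltac:(pose proof (Rmin_r d1 d2); lra)).
  unfold harmonic_fun.
  replace (hpart f z' + Cconj (gpart f z') - (hpart f z + Cconj (gpart f z)))%C
    with ((hpart f z' - hpart f z) + Cconj (gpart f z' - gpart f z))%C by (rewrite Cminus_conj; ring).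
  eapply Rle_lt_trans; [apply Cmod_triangle|]. rewrite Cmod_conj. lra.
Qed.

Lemma PH0_sub_KH0 f : class_PH0 0 f -> class_KH0 f.
Proof.
  intros Hf. assert (mono := PH0_monotone f Hf). pose proof Hf as [H0 P].
  split; [split; [exact H0|split]|].
  - intros z w Hz Hw E. apply NNPP. intros ne.
    assert (K := mono z w Hz Hw ne). rewrite E in K.
    replace (dot (f w - f w)%C (z - w)%C) with 0 in K by dot_ring. lra.
  - intros z Hz. specialize (P z Hz).
    change (Re (C_derive (hpart f) z) - 0 > Cmod (C_derive (gpart f) z)) in P.
    assert (A := re_le_Cmod (C_derive (hpart f) z)). apply Rabs_le_between in A.
    assert (G := Cmod_ge_0 (C_derive (gpart f) z)). nra.
  - apply monotone_close_to_convex; auto.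
    now apply analytic_pair_continuous, class_H0_analytic_pair.
Qed.

Lemma class_PH0_anti alpha beta f : alpha <= beta -> class_PH0 beta f -> class_PH0 alpha f.
Proof.
  intros H [H0 P]. split; auto. intros z Hz. specialize (P z Hz).
  change (Re (C_derive (hpart f) z) - beta > Cmod (C_derive (gpart f) z)) in P.
  change (Re (C_derive (hpart f) z) - alpha > Cmod (C_derive (gpart f) z)). lra.
Qed.

Theorem theorem1 :
  (forall alpha beta : R,
     0 <= alpha < 1 -> 0 <= beta < 1 ->
     0 <= 1 - 2 * (1 - alpha) * (1 - beta) ->
     forall f F : harmonic_map,
       class_PH0 alpha f -> class_GH0 beta F -> class_KH0 (harmonic_conv f F)) /\
  (forall f F : harmonic_map,
     class_PH0 0 f -> class_GH0 (1 / 2) F -> class_KH0 (harmonic_conv f F)) /\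
  (forall f F : harmonic_map,
     class_PH0 (1 / 2) f -> class_GH0 0 F -> class_KH0 (harmonic_conv f F)).
Proof.
  assert (main : forall alpha beta f F, alpha < 1 -> 0 <= 1 - 2 * (1 - alpha) * (1 - beta) ->
     class_PH0 alpha f -> class_GH0 beta F -> class_KH0 (harmonic_conv f F)).
  { intros alpha beta f F Hal Hg Hf HF.
    apply PH0_sub_KH0, (class_PH0_anti _ _ _ Hg). now apply harmonic_conv_PH0. }
  (* Both particular cases have gamma = 0. *)
  split; [|split]; intros; eapply main; eauto; lra.
Qed.
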